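(* Let $G$ be a subdivided $\Pi$-graph and let $u,v$ be two distinct branch vertices of $G$. Then there exist subgraphs $H_u,H_v\subseteq G$ such that $X:=V(H_u)\cap V(H_v)$ is non-empty and: (i) $H_u[X]=H_v[X]$, and this induced subgraph is finite and connected; (ii) $u,v\notin X$; (iii) $H_u/X$ is a subdivided $\Pi$-graph in which $u$ and $X$ are branch vertices, and $H_v/X$ is a subdivided $\Pi$-graph in which $v$ and $X$ are branch vertices; (iv) $uX$ is an edge of $H_u/X$ and $vX$ is an edge of $H_v/X$.
   Context: Graphs are simple and may be infinite. A graph is infinitely edge-connected if it has at least two vertices and $G-E'$ is connected for every finite edge set $E'$. A $\Pi$-graph is an infinitely edge-connected graph that does not contain infinitely many internally vertex-disjoint paths between any two of its vertices. A subdivided $\Pi$-graph is a graph $G$ that is a subdivision of a $\Pi$-graph $\Gamma$ (each edge of $\Gamma$ replaced by a path whose inner vertices are new); the vertices of $G$ corresponding to vertices of $\Gamma$ are its branch vertices. For a graph $H$ and a set $X\subseteq V(H)$ with $H[X]$ connected, $H/X$ denotes the graph obtained from $H$ by contracting $X$ to a single new vertex, itself denoted $X$: its vertex set is $(V(H)\setminus X)\cup\{X\}$, it contains all edges of $H-X$, and $X$ is adjacent to exactly those vertices outside $X$ that have a neighbour in $X$. *)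

(* Defs.v *)
From Stdlib Require Import List.
Import ListNotations.
Set Implicit Arguments.

Record graph (T : Type) := Graph { vert : T -> Prop; adj : T -> T -> Prop }.
Arguments Graph {T} _ _.
Arguments vert {T} _ _.
Arguments adj {T} _ _ _.

Section Graphs.
Variable T : Type.

Definition wf_graph (G : graph T) : Prop :=
  (forall x y, adj G x y -> adj G y x) /\
  (forall x, ~ adj G x x) /\
  (forall x y, adj G x y -> vert G x /\ vert G y).

Definition subgraph (H G : graph T) : Prop :=
  wf_graph H /\ (forall x, vert H x -> vert G x) /\
  (forall x y, adj H x y -> adj G x y).

Definition same_graph (G1 G2 : graph T) : Prop :=
  (forall x, vert G1 x <-> vert G2 x) /\ (forall x y, adj G1 x y <-> adj G2 x y).

Fixpoint walk (G : graph T) (p : list T) : Prop :=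
  match p with
  | [] => True
  | x :: q => match q with [] => True | y :: _ => adj G x y /\ walk G q end
  end.

Definition is_path (G : graph T) (x y : T) (p : list T) : Prop :=
  NoDup p /\ (forall z, In z p -> vert G z) /\ walk G p /\
  hd_error p = Some x /\ last p x = y.

Definition inner (p : list T) : list T := removelast (tl p).

Definition consecutive (x y : T) (p : list T) : Prop :=
  exists l1 l2, p = l1 ++ x :: y :: l2.

Definition connected (G : graph T) : Prop :=
  (exists x, vert G x) /\
  forall x y, vert G x -> vert G y -> exists p, is_path G x y p.

Definition finite_graph (G : graph T) : Prop :=
  exists l : list T, forall x, vert G x -> In x l.

Definition remove_edges (G : graph T) (F : list (T * T)) : graph T :=
  Graph (vert G) (fun x y => adj G x y /\ ~ In (x, y) F /\ ~ In (y, x) F).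

Definition inf_edge_connected (G : graph T) : Prop :=
  (exists x y, vert G x /\ vert G y /\ x <> y) /\
  forall F : list (T * T), connected (remove_edges G F).

Definition inf_disjoint_paths (G : graph T) (a b : T) : Prop :=
  exists P : nat -> list T,
    (forall i, is_path G a b (P i)) /\
    (forall i j, i <> j ->
       P i <> P j /\ forall z, In z (inner (P i)) -> ~ In z (inner (P j))).

Definition pi_graph (G : graph T) : Prop :=
  wf_graph G /\ inf_edge_connected G /\
  forall a b, vert G a -> vert G b -> ~ inf_disjoint_paths G a b.

(* G is a subdivision of Gam, where the vertices of Gam are identified with
   the branch vertices of G; every edge ab of Gam is replaced by the a--b path
   P a b of G whose inner vertices are new. *)
Definition subdivision_of (G Gam : graph T) : Prop :=
  wf_graph G /\ wf_graph Gam /\ (forall x, vert Gam x -> vert G x) /\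
  exists P : T -> T -> list T,
    (forall a b, adj Gam a b ->
       is_path G a b (P a b) /\ P b a = rev (P a b) /\
       forall z, In z (inner (P a b)) -> ~ vert Gam z) /\
    (forall a b c d, adj Gam a b -> adj Gam c d ->
       ~ (a = c /\ b = d) -> ~ (a = d /\ b = c) ->
       forall z, In z (inner (P a b)) -> ~ In z (inner (P c d))) /\
    (forall z, vert G z ->
       vert Gam z \/ exists a b, adj Gam a b /\ In z (inner (P a b))) /\
    (forall x y, adj G x y -> exists a b, adj Gam a b /\ consecutive x y (P a b)).

(* G is a subdivided Pi-graph, a subdivision of the Pi-graph Gam;
   the branch vertices of G are the vertices of Gam. *)
Definition subdivided_pi (G Gam : graph T) : Prop :=
  pi_graph Gam /\ subdivision_of G Gam.

Definition induced (H : graph T) (X : T -> Prop) : graph T :=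
  Graph (fun x => vert H x /\ X x) (fun x y => adj H x y /\ X x /\ X y).

Definition common_vert (H1 H2 : graph T) : T -> Prop :=
  fun x => vert H1 x /\ vert H2 x.

(* H/X: the contracted vertex X is represented by None *)
Definition contract (H : graph T) (X : T -> Prop) : graph (option T) :=
  Graph
    (fun o => match o with None => True | Some x => vert H x /\ ~ X x end)
    (fun o1 o2 => match o1, o2 with
       | Some x, Some y => adj H x y /\ ~ X x /\ ~ X y
       | None, Some y => vert H y /\ ~ X y /\ exists x, X x /\ adj H x y
       | Some x, None => vert H x /\ ~ X x /\ exists y, X y /\ adj H x y
       | None, None => False
       end).

End Graphs.

(* Main.v *)
(** By Menger-type greedy arguments, the absence of infinitely many independent
    [a]--[b] paths amounts to a finite set separating [a] from [b] once the edge
    [ab] is deleted.  In this form the property passes from a graph to its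
    subdivisions, subgraphs, contractions of finite vertex sets, and back from a
    subdivision to the subdivided graph.

    Let [S] separate [u] from [v] in [G], and let [Q_i] be edge-disjoint [u]--[v]
    paths in [G] avoiding the edge [uv].  By pigeonhole, infinitely many of them have
    the same first vertex [s] and the same last vertex [s'] in [S].  Keep these and
    let [X] be the interior of one of them.  In [G/X], the initial segments of the
    [Q_i] up to their first vertex in [X] run from [u] to [X] on the [u]-side of
    [S], and the final segments from [X] to [v] on the [v]-side, so that the two
    families meet only in [X].

    It remains to find, given an edge [uw] and [u]--[w] paths [p_i] such that every
    edge lies on finitely many of them, a subdivided Pi-graph in their union that
    contains the edge [uw].  Diagonalising, every vertex lies on cofinitely many
    or on finitely many [p_i]; let [W] be the set of the former.  No two vertices of
    [W] are joined by a [W]-path contained in infinitely many [p_i]: by finite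
    separation, infinitely many of those would meet in a vertex outside [W].  So a
    subsequence can be chosen greedily in which a vertex outside [W] lies on at
    most one path and a pair of vertices of [W] is joined by a [W]-segment of at
    most one path, the first path being [uw] itself.  Its union is a subdivision of
    a graph on [W], which is infinitely edge-connected since each finite set of
    edges spoils finitely many paths, while each vertex of [W] is on almost all. *)

From Stdlib Require Import List Arith Lia Relations ClassicalEpsilon.
From Stdlib Require Import FunctionalExtensionality PropExtensionality Cantor FinFun.
Require Import Defs.
Import ListNotations.
Set Implicit Arguments.
Unset Strict Implicit.

(** * Infinite sequences and choice *)

Definition eventually (P : nat -> Prop) : Prop := exists N, forall n, N <= n -> P n.
Definition frequently (P : nat -> Prop) : Prop := forall N, exists n, N <= n /\ P n.

Lemma not_eventually (P : nat -> Prop) : ~ eventually P -> frequently (fun n => ~ P n).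
Proof.
  intros H N. apply NNPP. intros H1. apply H. exists N. intros n Hn.
  apply NNPP. intros H2. apply H1. eauto.
Qed.

Lemma not_frequently (P : nat -> Prop) : ~ frequently P -> eventually (fun n => ~ P n).
Proof.
  intros H. apply NNPP. intros H1. apply H. apply not_eventually in H1.
  intros N. destruct (H1 N) as [n [Hn H2]]. exists n. split; auto. now apply NNPP.
Qed.

Lemma eventually_and (P Q : nat -> Prop) :
  eventually P -> eventually Q -> eventually (fun n => P n /\ Q n).
Proof.
  intros [N HN] [M HM]. exists (N + M). intros n Hn.
  split; [apply HN | apply HM]; lia.
Qed.

Lemma frequently_eventually (P Q : nat -> Prop) :
  frequently P -> eventually Q -> frequently (fun n => P n /\ Q n).
Proof.
  intros HP [M HM] N. destruct (HP (N + M)) as [n [Hn H]].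
  exists n. repeat split; auto; try apply HM; lia.
Qed.

Lemma eventually_impl (P Q : nat -> Prop) :
  (forall n, P n -> Q n) -> eventually P -> eventually Q.
Proof. intros H [N HN]. exists N. auto. Qed.

Lemma frequently_impl (P Q : nat -> Prop) :
  (forall n, P n -> Q n) -> frequently P -> frequently Q.
Proof. intros H HP N. destruct (HP N) as [n [Hn H1]]. eauto. Qed.

Lemma eventually_forall_list A (l : list A) (P : A -> nat -> Prop) :
  (forall x, In x l -> eventually (P x)) ->
  eventually (fun n => forall x, In x l -> P x n).
Proof.
  induction l as [|a l IH]; intros H.
  - exists 0. intros n _ x [].
  - assert (H1 : eventually (P a)) by (apply H; left; auto).
    assert (H2 : eventually (fun n => forall x, In x l -> P x n))
      by (apply IH; intros; apply H; right; auto).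
    eapply eventually_impl; [|exact (eventually_and H1 H2)].
    intros n [Ha Hl] x [<-|Hx]; auto.
Qed.

(** Otherwise each [P x] fails from some index on, and as [l] is finite, all of them fail together
    from some index on. *)
Lemma pigeonhole A (l : list A) (P : A -> nat -> Prop) :
  frequently (fun n => exists x, In x l /\ P x n) ->
  exists x, In x l /\ frequently (P x).
Proof.
  intros H. apply NNPP. intros H1.
  assert (H2 : eventually (fun n => forall x, In x l -> ~ P x n)).
  { apply eventually_forall_list. intros x Hx. apply not_frequently. eauto. }
  destruct (frequently_eventually H H2 0) as [n [_ [[x [Hx HP]] Hn]]].
  exact (Hn x Hx HP).
Qed.

Lemma choice_function A B (R : A -> B -> Prop) :
  (forall x, exists y, R x y) -> exists f, forall x, R x (f x).
Proof.
  intros H. exists (fun x => proj1_sig (constructive_indefinite_description _ (H x))).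
  intros x. exact (proj2_sig (constructive_indefinite_description _ (H x))).
Qed.

(** Dependent choice in which each term may depend on all earlier ones. The list of earlier terms is
    the state of the recursion; its length is recorded so that [R] can also refer to the index. *)
Lemma greedy A (R : list A -> A -> Prop) :
  (forall l, exists a, R l a) ->
  exists f : nat -> A, forall n, exists l,
    length l = n /\ (forall m, m < n -> In (f m) l) /\ R l (f n).
Proof.
  intros H. destruct (choice_function H) as [c Hc].
  pose (g := fix g n := match n with 0 => [] | S n => c (g n) :: g n end).
  exists (fun n => c (g n)). intros n. exists (g n). repeat split; auto.
  - induction n; simpl; auto.
  - induction n as [|n IH]; intros m Hm; [lia|].
    destruct (Nat.eq_dec m n) as [->|]; [left; auto|right; apply IH; lia].
Qed.

Lemma increasing_ge (f : nat -> nat) :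
  (forall m n, m < n -> f m < f n) -> forall n, n <= f n.
Proof.
  intros Hf n. induction n; [lia|]. specialize (Hf n (S n)). lia.
Qed.

Lemma eventually_subseq (f : nat -> nat) (P : nat -> Prop) :
  (forall m n, m < n -> f m < f n) -> eventually P -> eventually (fun n => P (f n)).
Proof.
  intros Hf [N HN]. exists N. intros n Hn. apply HN.
  pose proof (increasing_ge Hf n). lia.
Qed.

Lemma frequently_subseq (P : nat -> Prop) :
  frequently P ->
  exists f : nat -> nat, (forall m n, m < n -> f m < f n) /\ forall n, P (f n).
Proof.
  intros HP.
  destruct (@greedy _ (fun l n => P n /\ forall m, In m l -> m < n)) as [f Hf].
  { intros l. destruct (HP (S (list_max l))) as [n [Hn H]]. exists n. split; auto.
    intros m Hm. pose proof (proj1 (list_max_le l (list_max l)) (le_n _)) as HF.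
    rewrite Forall_forall in HF. specialize (HF m Hm). lia. }
  exists f. split.
  - intros m n Hmn. destruct (Hf n) as [l [_ [Hl [_ HR]]]]. auto.
  - intros n. destruct (Hf n) as [l [_ [_ [HR _]]]]. auto.
Qed.

Lemma diagonal (A : nat -> nat -> Prop) :
  exists f : nat -> nat, (forall m n, m < n -> f m < f n) /\
    forall k, eventually (fun n => A k (f n)) \/ eventually (fun n => ~ A k (f n)).
Proof.
  (* A decreasing chain of infinite index sets: stage [S k] keeps the indices inside [A k] if
     infinitely many survivors lie there, and those outside [A k] otherwise. *)
  pose (I := fix I k := match k with
    | 0 => fun _ => True
    | S k => fun n => I k n /\ (frequently (fun n => I k n /\ A k n) <-> A k n) end).
  assert (HI : forall k, frequently (I k)).
  { induction k as [|k IH].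
    - intros N. exists N. simpl. auto.
    - simpl. destruct (classic (frequently (fun n => I k n /\ A k n))) as [H|H].
      + eapply frequently_impl; [|exact H]. simpl. tauto.
      + pose proof (frequently_eventually IH (not_frequently H)) as H1.
        eapply frequently_impl; [|exact H1]. simpl. tauto. }
  assert (Hmono : forall j k n, j <= k -> I k n -> I j n).
  { intros j k n Hjk. induction Hjk; auto. simpl. tauto. }
  (* The diagonal sequence takes its [n]-th term from [I n], so all terms from index [S k] on lie in
     [I (S k)], where [A k] is decided. *)
  destruct (@greedy _ (fun l n => I (length l) n /\ forall m, In m l -> m < n)) as [f Hf].
  { intros l. destruct (HI (length l) (S (list_max l))) as [n [Hn H]].
    exists n. split; auto. intros m Hm.
    pose proof (proj1 (list_max_le l (list_max l)) (le_n _)) as HF.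
    rewrite Forall_forall in HF. specialize (HF m Hm). lia. }
  exists f. split.
  - intros m n Hmn. destruct (Hf n) as [l [_ [Hl [_ HR]]]]. auto.
  - intros k.
    assert (H : eventually (fun n => frequently (fun n => I k n /\ A k n) <-> A k (f n))).
    { exists (S k). intros n Hn. destruct (Hf n) as [l [<- [_ [HR _]]]].
      apply (Hmono (S k)) in HR; auto. simpl in HR. tauto. }
    destruct (classic (frequently (fun n => I k n /\ A k n))) as [H1|H1];
      [left|right]; (eapply eventually_impl; [|exact H]); simpl; tauto.
Qed.

(** A finite union of finite sets is finite, where finite means contained in a list. It translates
    finite sets of edges or vertices between a graph and its subdivision. *)
Lemma list_bound A B (l : list A) (P : A -> B -> Prop) :
  (forall x, In x l -> exists L, forall y, P x y -> In y L) ->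
  exists L, forall x y, In x l -> P x y -> In y L.
Proof.
  induction l as [|a l IH]; intros H.
  - exists []. intros x y [].
  - destruct (H a) as [L1 H1]; [left; auto|].
    destruct IH as [L2 H2]; [intros; apply H; right; auto|].
    exists (L1 ++ L2). intros x y [<-|Hx] HP; apply in_or_app; eauto.
Qed.

(** * Lists, paths and reachability *)

Section Lists.
Variable T : Type.
Implicit Types (x y z a b : T) (p q l m : list T).

Lemma consecutive_in x y p : consecutive x y p -> In x p /\ In y p.
Proof.
  intros [l1 [l2 ->]]. split; apply in_or_app; right; simpl; auto.
Qed.

Lemma consecutive_app x y p l1 l2 : consecutive x y p -> consecutive x y (l1 ++ p ++ l2).
Proof.
  intros [m1 [m2 ->]]. exists (l1 ++ m1), (m2 ++ l2). now rewrite <- !app_assoc.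
Qed.

Lemma consecutive_rev x y p : consecutive x y p -> consecutive y x (rev p).
Proof.
  intros [l1 [l2 ->]]. exists (rev l2), (rev l1).
  rewrite rev_app_distr. simpl. now rewrite <- !app_assoc.
Qed.

Lemma consecutive_cons x y a p :
  consecutive x y (a :: p) <-> (x = a /\ hd_error p = Some y) \/ consecutive x y p.
Proof.
  split.
  - intros [[|c l1] [l2 E]]; simpl in E; injection E as -> ->.
    + left; auto.
    + right. exists l1, l2; auto.
  - intros [[-> H]|[l1 [l2 ->]]].
    + destruct p as [|c p]; simpl in H; [discriminate|]. injection H as ->.
      exists [], p; auto.
    + exists (a :: l1), l2; auto.
Qed.

Lemma walk_consecutive (K : graph T) p :
  walk K p <-> forall x y, consecutive x y p -> adj K x y.
Proof.
  induction p as [|a [|b p] IH].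
  - split; [|simpl; auto]. intros _ x y [[|] [? E]]; discriminate.
  - split; [|simpl; auto]. intros _ x y H. apply consecutive_cons in H.
    destruct H as [[_ H]|[[|] [? E]]]; discriminate.
  - change (walk K (a :: b :: p)) with (adj K a b /\ walk K (b :: p)). rewrite IH.
    split.
    + intros [H1 H2] x y H. apply consecutive_cons in H.
      destruct H as [[-> H]|H]; auto. simpl in H. now injection H as <-.
    + intros H. split; [apply H; exists [], p; auto|].
      intros x y Hxy. apply H. apply consecutive_cons. auto.
Qed.

Lemma inner_ends x m y : inner (x :: m ++ [y]) = m.
Proof. unfold inner. simpl. apply removelast_last. Qed.

Lemma path_ends (K : graph T) x y p :
  is_path K x y p -> x <> y -> exists m, p = x :: m ++ [y].
Proof.
  intros (_ & _ & _ & H1 & H2) Hxy. destruct p as [|c p]; [discriminate|].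
  simpl in H1. injection H1 as ->.
  destruct (exists_last (l := p)) as [m [z ->]].
  - intros ->. simpl in H2. auto.
  - exists m. rewrite app_comm_cons, last_last in H2. now subst.
Qed.

Lemma path_intro (K : graph T) x m y :
  NoDup (x :: m ++ [y]) -> (forall z, In z (x :: m ++ [y]) -> vert K z) ->
  (forall a b, consecutive a b (x :: m ++ [y]) -> adj K a b) ->
  is_path K x y (x :: m ++ [y]).
Proof.
  intros H1 H2 H3. repeat split; auto.
  - now apply walk_consecutive.
  - rewrite app_comm_cons. apply last_last.
Qed.

Lemma rev_ends x m y : rev (x :: m ++ [y]) = y :: rev m ++ [x].
Proof. simpl. rewrite rev_app_distr. reflexivity. Qed.

Lemma in_inner (K : graph T) x y p z :
  is_path K x y p -> In z p -> z = x \/ z = y \/ In z (inner p).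
Proof.
  intros Hp Hz. destruct (classic (x = y)) as [->|Hxy].
  - destruct Hp as (Hnd & _ & _ & H1 & H2). destruct p as [|c p]; [discriminate|].
    simpl in H1. injection H1 as ->.
    destruct Hz as [->|Hz]; auto. destruct (exists_last (l := p)) as [m [w ->]].
    + now intros ->.
    + rewrite app_comm_cons, last_last in H2. subst.
      inversion Hnd as [|? ? Hn]. destruct Hn. apply in_or_app. simpl; auto.
  - destruct (path_ends Hp Hxy) as [m ->]. rewrite inner_ends.
    destruct Hz as [->|Hz]; auto. apply in_app_or in Hz. simpl in Hz. intuition.
Qed.

Lemma inner_in z p : In z (inner p) -> In z p.
Proof.
  destruct p as [|a p]; simpl; auto. unfold inner. simpl. intros H. right.
  destruct (exists_last (l := p)) as [m [w ->]].
  - intros ->. destruct H.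
  - rewrite removelast_last in H. apply in_or_app. auto.
Qed.

Lemma inner_rev p : inner (rev p) = rev (inner p).
Proof.
  destruct p as [|a p]; auto. destruct p as [|b p]; auto.
  destruct (exists_last (l := b :: p)) as [m [w E]]; [discriminate|].
  rewrite E. rewrite rev_ends, !inner_ends. auto.
Qed.

Lemma nodup_ends x m y : NoDup (x :: m ++ [y]) ->
  x <> y /\ ~ In x m /\ ~ In y m /\ NoDup m.
Proof.
  intros H. inversion H as [|? ? H1 H2]; subst.
  rewrite in_app_iff in H1. simpl in H1.
  apply NoDup_remove in H2. rewrite app_nil_r in H2. intuition.
Qed.

(** A vertex occurs only once on a path, so it determines what comes before and after it. *)
Lemma nodup_split z l1 l2 m1 m2 :
  NoDup (l1 ++ z :: l2) -> l1 ++ z :: l2 = m1 ++ z :: m2 -> l1 = m1 /\ l2 = m2.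
Proof.
  revert m1. induction l1 as [|a l1 IH]; intros [|b m1] Hnd E; simpl in *.
  - injection E. auto.
  - injection E as -> E. inversion Hnd as [|? ? H]. destruct H. rewrite E.
    apply in_or_app. simpl. auto.
  - injection E as -> E. inversion Hnd as [|? ? H]. destruct H.
    apply in_or_app. simpl. auto.
  - injection E as -> E. inversion Hnd; subst. destruct (IH _ H2 E). now subst.
Qed.

Lemma nodup_app_l l1 l2 : NoDup (l1 ++ l2) -> NoDup l1.
Proof.
  induction l1 as [|a l1 IH]; simpl; intros H; constructor; inversion H; subst; auto.
  rewrite in_app_iff in H2. auto.
Qed.

Lemma nodup_app_r l1 l2 : NoDup (l1 ++ l2) -> NoDup l2.
Proof. induction l1 as [|a l1 IH]; simpl; auto. intros H. inversion H; auto. Qed.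

Lemma consecutive_exists p z a b :
  In z (a :: b :: p) ->
  exists y, consecutive z y (a :: b :: p) \/ consecutive y z (a :: b :: p).
Proof.
  intros H. apply in_split in H. destruct H as [l1 [l2 E]].
  destruct l2 as [|y l2].
  - destruct (exists_last (l := l1)) as [l3 [y ->]].
    + intros ->. discriminate.
    + exists y. right. exists l3, []. rewrite E, <- app_assoc. reflexivity.
  - exists y. left. exists l1, l2. auto.
Qed.

Lemma first_in (P : T -> Prop) p :
  (exists z, In z p /\ P z) ->
  exists l1 z l2, p = l1 ++ z :: l2 /\ P z /\ forall y, In y l1 -> ~ P y.
Proof.
  induction p as [|a p IH]; intros [z [Hz Pz]]; [destruct Hz|].
  destruct (classic (P a)) as [Pa|Pa].
  - exists [], a, p. repeat split; auto.
  - destruct IH as [l1 [y [l2 [-> [Py Hl]]]]].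
    + exists z. destruct Hz as [->|Hz]; tauto.
    + exists (a :: l1), y, l2. repeat split; auto. intros w [<-|Hw]; auto.
Qed.

Lemma last_in (P : T -> Prop) p :
  (exists z, In z p /\ P z) ->
  exists l1 z l2, p = l1 ++ z :: l2 /\ P z /\ forall y, In y l2 -> ~ P y.
Proof.
  intros [z [Hz Pz]]. destruct (@first_in P (rev p)) as [l1 [y [l2 [E [Py Hl]]]]].
  - exists z. rewrite <- in_rev. auto.
  - exists (rev l2), y, (rev l1). repeat split; auto.
    + rewrite <- (rev_involutive p), E, rev_app_distr. simpl.
      now rewrite <- app_assoc.
    + intros w Hw. apply Hl. now apply in_rev.
Qed.

(** Reachability composes without any care for repeated vertices; [reach_path] returns to genuine
    paths. *)
Definition reach (K : graph T) : T -> T -> Prop := clos_refl_trans T (adj K).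

Lemma walk_reach (K : graph T) p x y :
  walk K (x :: p) -> In y (x :: p) -> reach K x y.
Proof.
  revert x. induction p as [|a p IH]; intros x Hw [<-|Hy]; try apply rt_refl.
  - destruct Hy.
  - destruct Hw as [H1 H2]. apply rt_trans with a; [apply rt_step; auto|].
    apply IH; auto.
Qed.

Lemma reach_sym (K : graph T) x y :
  (forall a b, adj K a b -> adj K b a) -> reach K x y -> reach K y x.
Proof.
  intros Hs H. induction H; [apply rt_step; auto|apply rt_refl|].
  eapply rt_trans; eauto.
Qed.

Lemma reach_ind_l (K : graph T) (P : T -> Prop) a :
  P a -> (forall x y, P x -> adj K x y -> P y) -> forall x, reach K a x -> P x.
Proof.
  intros Ha Hs x H. apply clos_rt_rtn1 in H. induction H; eauto.
Qed.

Lemma reach_sub (K L : graph T) a b :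
  (forall x y, adj K x y -> reach L x y) -> reach K a b -> reach L a b.
Proof.
  intros H Hab. induction Hab; [auto|apply rt_refl|eapply rt_trans; eauto].
Qed.

Lemma last_default p a b : p <> [] -> last p a = last p b.
Proof.
  intros H. destruct (exists_last H) as [l [z ->]]. now rewrite !last_last.
Qed.

(** Loop erasure: when a new first vertex already occurs on the path built so far, only the tail
    starting at that occurrence is kept. *)
Lemma reach_path (K : graph T) x y :
  (forall a b, adj K a b -> vert K a /\ vert K b) -> vert K x ->
  reach K x y -> exists p, is_path K x y p.
Proof.
  intros Hv Hx H. apply clos_rt_rt1n in H. induction H as [x|x z y Hxz _ IH].
  - exists [x]. repeat split; auto.
    + repeat constructor. intros [].
    + intros z [<-|[]]. auto.
  - destruct IH as [p Hp]; [apply (Hv x z Hxz)|].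
    destruct Hp as (Hnd & Hvp & Hw & Hh & Hl).
    destruct (classic (In x p)) as [Hin|Hin].
    + apply in_split in Hin. destruct Hin as [l1 [l2 ->]].
      exists (x :: l2). repeat split; auto.
      * eapply nodup_app_r; eauto.
      * intros w Hw'. apply Hvp. apply in_or_app. auto.
      * rewrite walk_consecutive in *. intros a b Hab. apply Hw.
        rewrite <- (app_nil_r (l1 ++ _)), <- app_assoc. now apply consecutive_app.
      * rewrite <- Hl. rewrite (@last_default (x :: l2) x z) by discriminate.
        clear. induction l1 as [|c l1 IH]; auto. simpl app. rewrite IH.
        simpl. destruct (l1 ++ x :: l2) eqn:E; auto. now destruct l1.
    + exists (x :: p). destruct p as [|c p]; [discriminate|].
      simpl in Hh. injection Hh as ->. repeat split; auto.
      * constructor; auto.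
      * intros w [<-|Hw']; auto.
      * rewrite <- Hl. apply (@last_default (z :: p)). discriminate.
Qed.

Lemma path_rev (K : graph T) x y p :
  (forall a b, adj K a b -> adj K b a) -> x <> y ->
  is_path K x y p -> is_path K y x (rev p).
Proof.
  intros Hs Hxy Hp. destruct (path_ends Hp Hxy) as [m ->].
  destruct Hp as (Hnd & Hv & Hw & _). rewrite rev_ends.
  apply path_intro; rewrite <- rev_ends.
  - now apply NoDup_rev.
  - intros z Hz. apply Hv. now apply in_rev.
  - intros a b Hab. apply consecutive_rev in Hab. rewrite rev_involutive in Hab.
    apply Hs. rewrite walk_consecutive in Hw. auto.
Qed.

End Lists.
(** * Finite separation *)

Section Separation.
Variable T : Type.
Implicit Types (G K : graph T) (a b x y z : T) (S m : list T).

Lemma consecutive_not_ends a b m x y :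
  NoDup (a :: m ++ [b]) -> consecutive x y (a :: m ++ [b]) -> x <> b /\ y <> a.
Proof.
  intros Hnd [l1 [l2 E]]. split; intros ->.
  - rewrite app_comm_cons in E, Hnd. destruct (nodup_split Hnd E). discriminate.
  - destruct (@nodup_split _ a [] (m ++ [b]) (l1 ++ [x]) l2) as [H _]; auto.
    + rewrite <- app_assoc. exact E.
    + now destruct l1.
Qed.

Lemma consecutive_ends a b m :
  NoDup (a :: m ++ [b]) -> consecutive a b (a :: m ++ [b]) -> m = [].
Proof.
  intros Hnd [l1 [l2 E]].
  destruct (@nodup_split _ a [] (m ++ [b]) l1 (b :: l2)) as [_ H]; auto.
  destruct (@nodup_split _ b m [] [] l2) as [H1 _]; auto.
  now inversion Hnd.
Qed.

(* Deletes the vertices of [S] except [a] and [b], and the edge [ab]; exempting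
   the ends means that [S] may contain them harmlessly. *)
Definition avoiding G S a b : graph T :=
  Graph (vert G) (fun x y => adj G x y /\
    (In x S -> x = a \/ x = b) /\ (In y S -> y = a \/ y = b) /\
    ~ (x = a /\ y = b) /\ ~ (x = b /\ y = a)).

Definition separated G a b : Prop := exists S, ~ reach (avoiding G S a b) a b.

Definition all_separated G : Prop :=
  forall a b, vert G a -> vert G b -> a <> b -> separated G a b.

Lemma avoiding_mono G K S L a b :
  (forall x y, adj K x y -> adj G x y) -> incl S L ->
  forall x y, reach (avoiding K L a b) x y -> reach (avoiding G S a b) x y.
Proof.
  intros H HS x y. apply reach_sub. intros c d (H1 & H2 & H3 & H4).
  apply rt_step. repeat split; auto; tauto.
Qed.

(** A path with an inner vertex does not use the edge [ab], since [a] and [b] occur only as its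
    ends. *)
Lemma path_avoiding G S a b m :
  is_path G a b (a :: m ++ [b]) -> m <> [] ->
  (forall z, In z m -> ~ In z S) -> reach (avoiding G S a b) a b.
Proof.
  intros (Hnd & _ & Hw & _) Hm HS. apply walk_reach with (m ++ [b]).
  2: { right. apply in_or_app. simpl; auto. }
  apply walk_consecutive. intros x y Hxy. rewrite walk_consecutive in Hw.
  assert (H : forall z, In z (a :: m ++ [b]) -> In z S -> z = a \/ z = b).
  { intros z [->|Hz] Hz'; auto. apply in_app_or in Hz. destruct Hz as [Hz|[->|[]]]; auto.
    now destruct (HS z). }
  destruct (consecutive_in Hxy) as [Hx Hy].
  repeat split; auto.
  - intros [-> ->]. apply Hm. now apply (consecutive_ends Hnd).
  - intros [-> ->]. now destruct (consecutive_not_ends Hnd Hxy).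
Qed.

(** All but at most one of the paths have an inner vertex and hence meet the finite separator
    inside; by pigeonhole two of them do so in the same vertex. *)
Lemma separated_not_inf_disjoint G a b :
  a <> b -> separated G a b -> ~ inf_disjoint_paths G a b.
Proof.
  intros Hab [S HS] [P [HP HD]].
  assert (Hm : forall i, inner (P i) <> [] -> exists z, In z S /\ In z (inner (P i))).
  { intros i Hi. apply NNPP. intros H. apply HS.
    specialize (HP i). destruct (path_ends HP Hab) as [m E]. rewrite E in *.
    rewrite inner_ends in *. apply (path_avoiding HP); auto. eauto. }
  (* Two paths without inner vertices would both be the list [[a; b]], but the paths are pairwise
     distinct. *)
  assert (H1 : eventually (fun i => inner (P i) <> [])).
  { apply NNPP. intros H. apply not_eventually in H.
    destruct (H 0) as [i [_ Hi]], (H (1 + i)) as [j [Hij Hj]].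
    apply NNPP in Hi, Hj.
    destruct (path_ends (HP i) Hab) as [m E], (path_ends (HP j) Hab) as [m' E'].
    destruct (HD i j) as [H1 _]; [lia|]. apply H1.
    rewrite E, E', inner_ends in *. now subst. }
  destruct (@pigeonhole _ S (fun z i => In z (inner (P i)))) as [z [Hz Hf]].
  { destruct H1 as [N HN]. intros M. exists (N + M). split; [lia|].
    apply Hm. apply HN. lia. }
  destruct (Hf 0) as [i [_ Hi]], (Hf (1 + i)) as [j [Hij Hj]].
  destruct (HD i j) as [_ H]; [lia|]. exact (H z Hi Hj).
Qed.

(** Without a finite separator the paths are chosen greedily, each avoiding all vertices of the
    earlier ones apart from [a] and [b], and also the edge [ab]. Their interiors are then non-empty
    and disjoint, which makes the paths distinct. *)
Lemma not_inf_disjoint_separated G a b :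
  wf_graph G -> vert G a -> a <> b -> ~ inf_disjoint_paths G a b -> separated G a b.
Proof.
  intros (Hs & Hi & Hv) Ha Hab Hn. apply NNPP. intros H. apply Hn.
  destruct (@greedy _ (fun l p => is_path G a b p /\ inner p <> [] /\
    forall q z, In q l -> In z q -> ~ In z (inner p))) as [P HP].
  - intros l.
    assert (Hr : reach (avoiding G (concat l) a b) a b).
    { apply NNPP. intros H1. apply H. now exists (concat l). }
    destruct (@reach_path _ (avoiding G (concat l) a b) a b) as [p Hp]; auto.
    { intros x y [Hxy _]. exact (Hv _ _ Hxy). }
    destruct (path_ends Hp Hab) as [m ->].
    destruct Hp as (Hnd & Hvp & Hw & H3). rewrite walk_consecutive in Hw.
    exists (a :: m ++ [b]). rewrite inner_ends. repeat split; auto; try tauto.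
    + apply walk_consecutive. intros x y Hxy. exact (proj1 (Hw _ _ Hxy)).
    + intros ->. destruct (Hw a b) as [_ [_ [_ [H1 _]]]]; [exists [], []|]; auto.
    + intros q z Hq Hz Hzm. destruct (nodup_ends Hnd) as (_ & Ham & Hbm & _).
      assert (Hin : In z (concat l)) by (apply in_concat; eauto).
      (* Some edge of the path is incident with [z], and edges at a deleted vertex survive only when
         that vertex is [a] or [b]. *)
      assert (Hz' : z = a \/ z = b).
      { destruct m as [|c m]; [destruct Hzm|].
        destruct (@consecutive_exists T (m ++ [b]) z a c) as [y [Hy|Hy]].
        - right. now apply (in_or_app (c :: m)); left.
        - apply Hw in Hy. apply Hy. auto.
        - apply Hw in Hy. apply Hy. auto. }
      now destruct Hz' as [->| ->].
  - exists P. split.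
    + intros i. destruct (HP i) as [l [_ [_ [Hp _]]]]. auto.
    + assert (Hlt : forall i j, i < j -> forall z, In z (inner (P i)) -> ~ In z (inner (P j))).
      { intros i j Hij z Hz. destruct (HP j) as [l [_ [Hl [_ [_ HR]]]]].
        apply (HR (P i)); auto. now apply inner_in. }
      assert (Hd : forall i j, i <> j -> forall z, In z (inner (P i)) -> ~ In z (inner (P j))).
      { intros i j Hij z Hz Hz'. destruct (Nat.lt_total i j) as [H1|[H1|H1]]; eauto.
        - exact (Hlt _ _ H1 _ Hz Hz').
        - exact (Hlt _ _ H1 _ Hz' Hz). }
      intros i j Hij. split; [intros E|exact (Hd i j Hij)].
      destruct (HP i) as [l [_ [_ [_ [Hne _]]]]].
      destruct (inner (P i)) as [|z m] eqn:E'; auto.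
      apply (Hd i j Hij z); rewrite <- ?E, E'; simpl; auto.
Qed.

Lemma all_separated_no_inf_disjoint G :
  all_separated G -> forall a b, vert G a -> vert G b -> ~ inf_disjoint_paths G a b.
Proof.
  intros H a b Ha Hb. destruct (classic (a = b)) as [->|Hab].
  2: apply separated_not_inf_disjoint; auto.
  (* For equal ends the only path is the trivial one, so there are no two distinct paths. *)
  intros [P [HP HD]].
  assert (E : forall i, P i = [b]).
  { intros i. destruct (HP i) as (Hnd & _ & _ & Hh & Hl).
    destruct (P i) as [|c p]; [discriminate|]. simpl in Hh. injection Hh as ->.
    destruct p as [|c p]; auto. exfalso. inversion Hnd as [|? ? Hn]. apply Hn.
    rewrite <- Hl at 1. change (last (b :: c :: p) b) with (last (c :: p) b).
    destruct (exists_last (l := c :: p)) as [m [w ->]]; [discriminate|].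
    rewrite last_last. apply in_or_app. simpl; auto. }
  destruct (HD 0 1) as [H1 _]; [lia|]. apply H1. now rewrite !E.
Qed.

Lemma separated_sym G a b :
  (forall x y, adj G x y -> adj G y x) -> separated G a b -> separated G b a.
Proof.
  intros Hs [S HS]. exists S. intros H. apply HS. apply reach_sym.
  - simpl. intros x y (H1 & H2). split; auto. tauto.
  - revert H. apply reach_sub. intros x y H. apply rt_step. simpl in *. tauto.
Qed.

End Separation.

(** * Subdivisions *)

Section Subdivision.
Variables (T : Type) (G Gam : graph T).
Hypothesis Hsub : subdivision_of G Gam.
Variable P : T -> T -> list T.
Hypothesis HP : forall a b, adj Gam a b ->
  is_path G a b (P a b) /\ P b a = rev (P a b) /\
  forall z, In z (inner (P a b)) -> ~ vert Gam z.
Hypothesis HD : forall a b c d, adj Gam a b -> adj Gam c d ->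
  ~ (a = c /\ b = d) -> ~ (a = d /\ b = c) ->
  forall z, In z (inner (P a b)) -> ~ In z (inner (P c d)).

Let HwfG : wf_graph Gam := proj1 (proj2 Hsub).

Lemma adj_branch a b : adj Gam a b -> vert Gam a /\ vert Gam b /\ a <> b.
Proof.
  destruct HwfG as (_ & Hi & Hv). intros H. destruct (Hv _ _ H). repeat split; auto.
  intros ->. exact (Hi _ H).
Qed.

Lemma subdivided_edge_ends a b : adj Gam a b -> exists m, P a b = a :: m ++ [b].
Proof. intros H. apply (path_ends (proj1 (HP H))). now apply adj_branch. Qed.

Lemma inner_edge_unique a b c d z :
  adj Gam a b -> adj Gam c d -> In z (inner (P a b)) -> In z (inner (P c d)) ->
  (a = c /\ b = d) \/ (a = d /\ b = c).
Proof.
  intros Hab Hcd Hz Hz'. apply NNPP. intros H.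
  apply (HD Hab Hcd) with z; auto; tauto.
Qed.

Lemma consecutive_cases a b x y :
  adj Gam a b -> consecutive x y (P a b) ->
  (x = a \/ In x (inner (P a b))) /\ (y = b \/ In y (inner (P a b))).
Proof.
  intros Hab Hxy. destruct (HP Hab) as [Hp _]. destruct (consecutive_in Hxy) as [Hx Hy].
  apply (in_inner Hp) in Hx, Hy.
  destruct (subdivided_edge_ends Hab) as [m E]. rewrite E in *. destruct Hp as [Hnd _].
  destruct (consecutive_not_ends Hnd Hxy). intuition.
Qed.

(** An inner vertex belongs to the path of only one edge of [Gam]; if neither [x] nor [y] is inner,
    both paths replace the edge [xy] itself. *)
Lemma consecutive_edge_unique a b c d x y :
  adj Gam a b -> adj Gam c d -> consecutive x y (P a b) -> consecutive x y (P c d) ->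
  (a = c /\ b = d) \/ (a = d /\ b = c).
Proof.
  intros Hab Hcd H1 H2.
  destruct (consecutive_cases Hab H1) as [Hx Hy], (consecutive_cases Hcd H2) as [Hx' Hy'].
  destruct (adj_branch Hab) as (Ha & Hb & _), (adj_branch Hcd) as (Hc & Hd & _).
  destruct (HP Hab) as (_ & _ & Hn), (HP Hcd) as (_ & _ & Hn').
  destruct Hx as [->|Hx].
  - destruct Hx' as [->|Hx']; [|now destruct (Hn' a)].
    destruct Hy as [->|Hy].
    + destruct Hy' as [->|Hy']; [auto|now destruct (Hn' b)].
    + destruct Hy' as [->|Hy']; [now destruct (Hn d)|].
      exact (inner_edge_unique Hab Hcd Hy Hy').
  - destruct Hx' as [->|Hx']; [now destruct (Hn c)|].
    exact (inner_edge_unique Hab Hcd Hx Hx').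
Qed.

Lemma edge_path_adj a b x y : adj Gam a b -> consecutive x y (P a b) -> adj G x y.
Proof.
  intros Hab Hxy. destruct (HP Hab) as [(_ & _ & Hw & _) _].
  rewrite walk_consecutive in Hw. auto.
Qed.

Lemma edge_path_reach (K : graph T) a b :
  adj Gam a b -> (forall x y, consecutive x y (P a b) -> adj K x y) -> reach K a b.
Proof.
  intros Hab H. destruct (subdivided_edge_ends Hab) as [m E].
  apply walk_reach with (m ++ [b]).
  - rewrite <- E. now apply walk_consecutive.
  - right. apply in_or_app. simpl; auto.
Qed.

Lemma inner_rev_edge a b z :
  adj Gam a b -> In z (inner (P a b)) -> In z (inner (P b a)).
Proof.
  intros Hab Hz. destruct (HP Hab) as (_ & -> & _). rewrite inner_rev.
  now apply in_rev in Hz.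
Qed.

(** Each deleted edge of [G] spoils the path of at most one edge of [Gam]. Once these finitely many
    edges are deleted from [Gam], every remaining one still has its whole path in [G]. *)
Lemma subdivision_reach_remove (F : list (T * T)) a b :
  (forall L, reach (remove_edges Gam L) a b) -> reach (remove_edges G F) a b.
Proof.
  intros H.
  destruct (@list_bound _ _ F (fun e e' => adj Gam (fst e') (snd e') /\
    consecutive (fst e) (snd e) (P (fst e') (snd e')))) as [L HL].
  { intros [x y] _. destruct (classic (exists c d, adj Gam c d /\ consecutive x y (P c d)))
      as [[c [d [Hcd Hxy]]]|Hn].
    - exists [(c, d); (d, c)]. intros [c' d'] [Hc' Hxy']. simpl in *.
      destruct (consecutive_edge_unique Hcd Hc' Hxy Hxy') as [[-> ->]|[-> ->]]; auto.
    - exists []. intros [c d] [H1 H2]. apply Hn. exists c, d. auto. }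
  specialize (H L). revert H. apply reach_sub. intros c d (Hcd & H1 & H2).
  apply (edge_path_reach Hcd). intros x y Hxy. repeat split.
  - exact (edge_path_adj Hcd Hxy).
  - intros HF. apply H1. apply (HL _ (c, d) HF). simpl. auto.
  - intros HF. apply H2. apply (HL _ (d, c) HF). simpl. split.
    + now apply HwfG.
    + destruct (HP Hcd) as (_ & -> & _). now apply consecutive_rev.
Qed.

Lemma subdivision_separated_branch a b :
  (forall x y, adj G x y -> exists c d, adj Gam c d /\ consecutive x y (P c d)) ->
  vert Gam a -> vert Gam b -> a <> b -> separated Gam a b -> separated G a b.
Proof.
  (* The edge [ab], which [avoiding] deletes from [Gam], may be a longer path in [G]; its interior
     is added to the separator. If [ab] is no edge, the added vertices do no harm. *)
  intros HE Ha Hb Hab [S HS]. exists (S ++ inner (P a b) ++ inner (P b a)). intros Hr.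
  set (ok x := In x S -> x = a \/ x = b).
  (* The invariant along a walk in [G]: it is at a reachable branch vertex of [Gam], or inside the
     path of an edge with a reachable, undeleted end. *)
  set (R z := (vert Gam z /\ ok z /\ reach (avoiding Gam S a b) a z) \/
    exists c d, adj Gam c d /\ In z (inner (P c d)) /\ ok c /\
      reach (avoiding Gam S a b) a c).
  assert (HR : R b).
  2: { destruct HR as [(_ & _ & H)|[c [d (Hcd & Hz & _)]]]; auto.
       now destruct (HP Hcd) as (_ & _ & Hn), (Hn b). }
  revert Hr. apply (@reach_ind_l _ (avoiding G _ a b) R).
  { left. repeat split; [auto|intros _; auto|apply rt_refl]. }
  intros x y Hx (Hxy & Hokx & Hoky & Hn1 & Hn2).
  rewrite !in_app_iff in Hokx, Hoky.
  destruct (HE _ _ Hxy) as [c [d [Hcd Hc]]].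
  destruct (consecutive_cases Hcd Hc) as [Hxc Hyd].
  destruct (adj_branch Hcd) as (Vc & Vd & Ncd).
  destruct (HP Hcd) as (_ & _ & Hnb).
  assert (Hstep : forall c d, adj Gam c d -> ok c -> ok d ->
     ~ (c = a /\ d = b) -> ~ (c = b /\ d = a) -> reach (avoiding Gam S a b) a c ->
     reach (avoiding Gam S a b) a d).
  { intros c' d' H1 H2 H3 H4 H5 H6. eapply rt_trans; [exact H6|]. apply rt_step.
    repeat split; auto. }
  destruct Hx as [(Vx & Okx & Rx)|[c' [d' (Hcd' & Hin & Okc & Rc)]]].
  - destruct Hxc as [->|Hxc]; [|now destruct (Hnb x)].
    destruct Hyd as [->|Hyd].
    + left. repeat split; [auto|unfold ok; tauto|]. apply (Hstep c d); auto. unfold ok; tauto.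
    + right. exists c, d. auto.
  - destruct Hxc as [->|Hxc]; [now destruct (HP Hcd') as (_ & _ & Hnb'), (Hnb' c)|].
    destruct (inner_edge_unique Hcd' Hcd Hin Hxc) as [[-> ->]|[-> ->]].
    + destruct Hyd as [->|Hyd]; [|right; exists c, d; auto].
      assert (okd : ok d) by (unfold ok; tauto).
      left. repeat split; auto. apply (Hstep c d); auto.
      * intros [-> ->]. destruct Hokx as [->| ->]; auto; now apply (Hnb _ Hxc).
      * intros [-> ->]. destruct Hokx as [->| ->]; auto; now apply (Hnb _ Hxc).
    + destruct Hyd as [->|Hyd]; [left; auto|].
      right. exists d, c. repeat split; auto. now apply inner_rev_edge.
Qed.

(** All neighbours of an inner vertex lie on the path of its edge. Deleting that path and the edge
    [ab] therefore leaves [a] with no way out. *)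
Lemma separated_inner a b c d :
  (forall x y, adj G x y -> exists c d, adj Gam c d /\ consecutive x y (P c d)) ->
  a <> b -> adj Gam c d -> In a (inner (P c d)) -> separated G a b.
Proof.
  intros HE Hab Hcd Ha. exists (P c d). intros Hr.
  assert (E : a = b); [|auto]. revert Hr.
  assert (H : forall x, reach (avoiding G (P c d) a b) a x -> a = x).
  { apply reach_ind_l; auto. intros x y <- (Hxy & _ & Hok & Hn & _).
    destruct (HE _ _ Hxy) as [c' [d' [Hcd' Hc]]].
    destruct (consecutive_cases Hcd' Hc) as [[->|Hi] _].
    { destruct (HP Hcd) as (_ & _ & Hnb). destruct (Hnb c'); auto.
      now apply adj_branch in Hcd'. }
    assert (Hy : In y (P c d)).
    { destruct (consecutive_in Hc) as [_ Hy].
      destruct (inner_edge_unique Hcd Hcd' Ha Hi) as [[-> ->]|[-> ->]]; auto.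
      destruct (HP Hcd') as (_ & -> & _). now apply -> in_rev. }
    destruct (Hok Hy) as [->| ->]; auto. tauto. }
  apply H.
Qed.

Lemma subdivision_separated_down a b :
  vert Gam a -> vert Gam b -> a <> b -> separated G a b -> separated Gam a b.
Proof.
  intros Ha Hb Hab [S HS].
  (* Each vertex of [S] contributes itself and, if it is inner, both ends of its edge of [Gam]. *)
  destruct (@list_bound _ _ S (fun s z => z = s \/
     exists d, adj Gam z d /\ In s (inner (P z d)))) as [L HL].
  { intros s _. destruct (classic (exists c d, adj Gam c d /\ In s (inner (P c d))))
      as [[c [d [Hcd Hs]]]|Hn].
    - exists [s; c; d]. intros z [->|[e [Hze Hz]]]; simpl; auto.
      destruct (inner_edge_unique Hcd Hze Hs Hz) as [[-> ->]|[-> ->]]; auto.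
    - exists [s]. intros z [->|[e [Hze Hz]]]; simpl; auto. destruct Hn; eauto. }
  exists L. intros Hr. apply HS. revert Hr. apply reach_sub.
  intros c d (Hcd & Hc & Hd & Hn1 & Hn2).
  destruct (adj_branch Hcd) as (Vc & Vd & Ncd).
  destruct (HP Hcd) as (_ & _ & Hnb).
  (* If the path of [cd] met [S] inside, both [c] and [d] would be in [L], hence among [a] and [b];
     then [cd] would be the deleted edge. *)
  assert (Hin : forall z, In z (inner (P c d)) -> ~ In z S).
  { intros z Hz HzS.
    assert (Lc : c = a \/ c = b) by (apply Hc; apply (HL z); eauto).
    assert (Ld : d = a \/ d = b).
    { apply Hd. apply (HL z); auto. right. exists c. split; [now apply HwfG|].
      now apply inner_rev_edge. }
    destruct Lc, Ld; subst; tauto. }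
  apply (edge_path_reach Hcd). intros x y Hxy.
  destruct (consecutive_cases Hcd Hxy) as [Hx Hy].
  assert (Hb1 : forall z, In z (P c d) -> In z S -> z = a \/ z = b).
  { intros z Hz HzS. destruct (in_inner (proj1 (HP Hcd)) Hz) as [->|[->|Hz']].
    - apply Hc. apply (HL c); auto.
    - apply Hd. apply (HL d); auto.
    - now destruct (Hin z). }
  destruct (consecutive_in Hxy).
  repeat split; auto.
  - exact (edge_path_adj Hcd Hxy).
  - intros [-> ->]. destruct Hx as [->|Hx]; [|now apply (Hnb a)].
    destruct Hy as [->|Hy]; [tauto|now apply (Hnb b)].
  - intros [-> ->]. destruct Hx as [->|Hx]; [|now apply (Hnb b)].
    destruct Hy as [->|Hy]; [tauto|now apply (Hnb a)].
Qed.

End Subdivision.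

Lemma subdivision_all_separated T (G Gam : graph T) :
  subdivision_of G Gam -> all_separated Gam -> all_separated G.
Proof.
  intros Hsub HG a b Ha Hb Hab.
  pose proof Hsub as (HwG & HwGam & Hv & P & HP & HD & HV & HE).
  destruct (HV a Ha) as [Ba|[c [d [Hcd Hc]]]].
  - destruct (HV b Hb) as [Bb|[c [d [Hcd Hc]]]].
    + apply subdivision_separated_branch with (P := P) (Gam := Gam); auto.
    + apply separated_sym; [apply HwG|].
      apply separated_inner with (P := P) (Gam := Gam) (c := c) (d := d); auto.
  - apply separated_inner with (P := P) (Gam := Gam) (c := c) (d := d); auto.
Qed.

Lemma subdivision_all_separated_down T (G Gam : graph T) :
  subdivision_of G Gam -> all_separated G -> all_separated Gam.
Proof.
  intros Hsub HG a b Ha Hb Hab.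
  pose proof Hsub as (HwG & HwGam & Hv & P & HP & HD & HV & HE).
  apply subdivision_separated_down with (P := P) (G := G); auto.
Qed.

(** * Contractions *)

Section Contraction.
Variables (T : Type) (G : graph T) (X : T -> Prop).

Lemma contract_wf : wf_graph G -> wf_graph (contract G X).
Proof.
  intros (Hs & Hi & Hv). repeat split.
  - intros [x|] [y|]; simpl; auto; try tauto.
    + intuition.
    + intros (H1 & H2 & z & H3 & H4). eauto 6.
    + intros (H1 & H2 & z & H3 & H4). eauto 6.
  - intros [x|]; simpl; auto. intros (H & _). exact (Hi _ H).
  - destruct x as [x|], y as [y|]; simpl in *; try tauto.
    split; [apply (Hv x y)|]; tauto.
  - destruct x as [x|], y as [y|]; simpl in *; try tauto.
    split; [apply (Hv x y)|]; tauto.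
Qed.

(** With the contracted vertex put into the separator, every remaining walk lives in [G]. *)
Lemma contract_separated_old a b :
  separated G a b -> separated (contract G X) (Some a) (Some b).
Proof.
  intros [S HS]. exists (None :: map Some S). intros Hr. apply HS.
  assert (H : forall o, reach (avoiding (contract G X) (None :: map Some S) (Some a) (Some b))
      (Some a) o -> exists z, o = Some z /\ reach (avoiding G S a b) a z).
  { apply reach_ind_l.
    - exists a. split; auto. apply rt_refl.
    - intros x y [z [-> Hz]] (Hxy & Hok & Hok' & Hn1 & Hn2).
      destruct y as [y|]; [|destruct Hok' as [|]; simpl; auto; discriminate].
      exists y. split; auto. eapply rt_trans; [exact Hz|]. apply rt_step.
      destruct Hxy as (Hxy & _). repeat split; auto.
      + intros Hi. destruct Hok as [E|E]; [right; now apply in_map|..]; injection E; auto.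
      + intros Hi. destruct Hok' as [E|E]; [right; now apply in_map|..]; injection E; auto.
      + intros [-> ->]. tauto.
      + intros [-> ->]. tauto. }
  destruct (H _ Hr) as [z [E Hz]]. now injection E as ->.
Qed.

(** As the contracted set is finite, the separators of [a] from its vertices can be united into one
    finite set. *)
Lemma contract_separated_new a (l : list T) :
  (forall x, X x -> In x l) -> ~ X a -> (forall x, X x -> separated G a x) ->
  separated (contract G X) (Some a) None.
Proof.
  intros Hl Ha Hsep.
  assert (HL : exists L, forall x, In x l -> X x -> ~ reach (avoiding G L a x) a x).
  { clear Hl. induction l as [|x l' IH].
    - exists []. intros x [].
    - destruct IH as [L IH].
      destruct (classic (X x)) as [Hx|Hx].
      + destruct (Hsep _ Hx) as [S HS]. exists (S ++ L).
        intros y Hy HX Hr. destruct Hy as [<-|Hy].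
        * apply HS. revert Hr. apply avoiding_mono; auto. now apply incl_appl, incl_refl.
        * apply (IH y); auto. revert Hr. apply avoiding_mono; auto.
          now apply incl_appr, incl_refl.
      + exists L. intros y [<-|Hy]; auto. }
  destruct HL as [L HL]. exists (map Some L). intros Hr.
  (* The walk stays outside [X], and its vertices are reachable in all the graphs [avoiding G L a x]
     at once. *)
  assert (H : forall o, reach (avoiding (contract G X) (map Some L) (Some a) None)
      (Some a) o -> exists z, o = Some z /\ ~ X z /\
      forall x, X x -> reach (avoiding G L a x) a z).
  { apply reach_ind_l.
    - exists a. repeat split; auto. intros. apply rt_refl.
    - intros o o' [z [-> [Hz Hrz]]] (Hxy & Hok & Hok' & Hn1 & Hn2).
      destruct o' as [y|].
      + destruct Hxy as (Hxy & _ & HXy). exists y. repeat split; auto. intros x Hx.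
        eapply rt_trans; [apply (Hrz _ Hx)|]. apply rt_step. repeat split; auto.
        * intros Hi. destruct Hok as [E|E]; [now apply in_map|..]; [injection E; auto|discriminate].
        * intros Hi. destruct Hok' as [E|E]; [now apply in_map|..]; [injection E; auto|discriminate].
        * intros [-> ->]. tauto.
        * intros [-> ->]. tauto.
      (* The edge from [a] to the contracted vertex is deleted, so [z] is not [a]. The edge [zx]
         thus survives in [avoiding G L a x] and completes a forbidden walk. *)
      + exfalso. destruct Hxy as (_ & _ & x & Hx & Hzx).
        apply (HL x); auto. eapply rt_trans; [apply (Hrz _ Hx)|]. apply rt_step.
        repeat split; auto.
        * intros Hi. destruct Hok as [E|E]; [now apply in_map|..]; [injection E; auto|discriminate].
        * intros [-> _]. tauto.
        * intros [-> ->]. tauto. }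
  destruct (H _ Hr) as [z [E _]]. discriminate.
Qed.

Lemma contract_all_separated (l : list T) :
  wf_graph G -> (forall x, X x -> In x l /\ vert G x) ->
  all_separated G -> all_separated (contract G X).
Proof.
  intros Hwf Hl Hsep.
  assert (H : forall a, vert G a -> ~ X a -> separated (contract G X) (Some a) None).
  { intros a Ha HXa. apply contract_separated_new with l; auto.
    - intros x Hx. now apply Hl.
    - intros x Hx. apply Hsep; auto; [now apply Hl|congruence]. }
  intros [a|] [b|] Ha Hb Hab; simpl in *.
  - apply contract_separated_old. apply Hsep; try tauto. congruence.
  - now apply H.
  - apply separated_sym; [apply (contract_wf Hwf)|]. now apply H.
  - tauto.
Qed.

End Contraction.
(** * Subdivided Pi-graphs in unions of paths *)

Local Ltac app_normalize := simpl; repeat (rewrite <- !app_assoc; simpl).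

Section Segments.
Variables (T : Type) (W : T -> Prop).
Implicit Types (a b c d x y z : T) (p s t m l : list T).

(** A [W]-path contained in [p], traversed in the direction of [p]. *)
Definition segment p a b s : Prop :=
  W a /\ W b /\ exists m l1 l2, s = a :: m ++ [b] /\ p = l1 ++ s ++ l2 /\
    forall z, In z m -> ~ W z.

Lemma first_unique m b l m' b' l' :
  m ++ b :: l = m' ++ b' :: l' ->
  (forall z, In z m -> ~ W z) -> (forall z, In z m' -> ~ W z) -> W b -> W b' ->
  m = m' /\ b = b'.
Proof.
  intros E Hm Hm' Hb Hb'. revert m' E Hm'.
  induction m as [|x m IH]; intros [|y m'] E Hm'; simpl in E.
  - now injection E.
  - injection E as -> _. now destruct (Hm' y); [left|].
  - injection E as -> _. now destruct (Hm b'); [left|].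
  - injection E as -> E. destruct (IH (fun z Hz => Hm z (or_intror Hz)) m' E) as [-> ->];
      auto. intros z Hz. apply Hm'. now right.
Qed.

Lemma last_unique l b m l' b' m' :
  l ++ b :: m = l' ++ b' :: m' ->
  (forall z, In z m -> ~ W z) -> (forall z, In z m' -> ~ W z) -> W b -> W b' ->
  m = m' /\ b = b'.
Proof.
  intros E Hm Hm' Hb Hb'. apply (f_equal (@rev T)) in E.
  rewrite !rev_app_distr in E. simpl in E. rewrite <- !app_assoc in E. simpl in E.
  destruct (first_unique E) as [E1 E2]; auto.
  - intros z Hz. apply Hm. now apply in_rev.
  - intros z Hz. apply Hm'. now apply in_rev.
  - split; auto. now rewrite <- (rev_involutive m), E1, rev_involutive.
Qed.

Lemma segment_nodup p a b s : NoDup p -> segment p a b s -> NoDup s /\ a <> b.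
Proof.
  intros Hnd (_ & _ & m & l1 & l2 & -> & -> & _).
  assert (H : NoDup (a :: m ++ [b])) by (eapply nodup_app_l, nodup_app_r; eauto).
  split; auto. now apply (nodup_ends H).
Qed.

Lemma segment_in p a b s z : segment p a b s -> In z s -> In z p.
Proof.
  intros (_ & _ & m & l1 & l2 & _ & -> & _) Hz. rewrite !in_app_iff. auto.
Qed.

Lemma segment_ends p a b s : segment p a b s -> In a p /\ In b p.
Proof.
  intros H. split; apply (segment_in H); destruct H as (_ & _ & m & l1 & l2 & -> & _).
  - left; auto.
  - right. apply in_or_app. simpl; auto.
Qed.

Lemma segment_inner p a b s z : segment p a b s -> In z (inner s) -> ~ W z /\ In z p.
Proof.
  intros H Hz. split; [|apply (segment_in H); now apply inner_in].
  destruct H as (_ & _ & m & l1 & l2 & -> & _ & Hm). rewrite inner_ends in Hz. auto.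
Qed.

(** The segment starting at [a] stops at the first vertex of [W] after [a]. *)
Lemma segment_unique p a b s d t :
  NoDup p -> segment p a b s -> segment p a d t -> s = t.
Proof.
  intros Hnd (_ & Hb & m & l1 & l2 & -> & E & Hm) (_ & Hd & m' & l1' & l2' & -> & E' & Hm').
  subst p. simpl in *. destruct (nodup_split Hnd E') as [_ E].
  rewrite <- !app_assoc in E. destruct (first_unique E) as [-> ->]; auto.
Qed.

Lemma segment_not_rev p a b s t :
  NoDup p -> segment p a b s -> segment p b a t -> False.
Proof.
  intros Hnd (_ & _ & m & l1 & l2 & -> & E & _) (_ & _ & m' & l1' & l2' & -> & E' & _).
  assert (E1 : p = (l1 ++ a :: m) ++ b :: l2).
  { rewrite E. app_normalize. reflexivity. }
  assert (E2 : p = l1' ++ b :: m' ++ a :: l2').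
  { rewrite E'. app_normalize. reflexivity. }
  rewrite E1 in Hnd, E2. destruct (nodup_split Hnd E2) as [_ ->].
  rewrite <- app_assoc in Hnd. apply nodup_app_r in Hnd.
  inversion Hnd as [|? ? Hn]. apply Hn. rewrite !in_app_iff. simpl.
  rewrite in_app_iff. simpl. auto.
Qed.

(** The ends of a segment are the nearest vertices of [W] on either side of any of its inner
    vertices. *)
Lemma segment_inner_unique p a b s c d t z :
  NoDup p -> segment p a b s -> segment p c d t ->
  In z (inner s) -> In z (inner t) -> a = c /\ b = d.
Proof.
  intros Hnd (Ha & Hb & m & l1 & l2 & -> & E & Hm) (Hc & Hd & m' & l1' & l2' & -> & E' & Hm').
  rewrite !inner_ends. intros Hz Hz'.
  apply in_split in Hz, Hz'. destruct Hz as [k1 [k2 ->]], Hz' as [k1' [k2' ->]].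
  assert (E1 : p = (l1 ++ a :: k1) ++ z :: k2 ++ b :: l2).
  { rewrite E. app_normalize. reflexivity. }
  assert (E2 : p = (l1' ++ c :: k1') ++ z :: k2' ++ d :: l2').
  { rewrite E'. app_normalize. reflexivity. }
  rewrite E1 in Hnd, E2. destruct (nodup_split Hnd E2) as [E3 E4].
  split.
  - apply (last_unique E3); auto; intros x Hx; [apply Hm|apply Hm'];
      apply in_or_app; auto.
  - apply (first_unique E4); auto; intros x Hx; [apply Hm|apply Hm'];
      apply in_or_app; simpl; auto.
Qed.

Lemma segment_vertex u m w z :
  W u -> W w -> In z (u :: m ++ [w]) -> ~ W z ->
  exists a b s, segment (u :: m ++ [w]) a b s /\ In z (inner s).
Proof.
  intros Hu Hw [<-|Hz] Hn; [tauto|]. apply in_app_or in Hz.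
  destruct Hz as [Hz|[<-|[]]]; [|tauto]. apply in_split in Hz. destruct Hz as [l1 [l2 ->]].
  destruct (@last_in _ W (u :: l1)) as [k1 [a [k2 [E1 [Ha Hk]]]]].
  { exists u. simpl; auto. }
  destruct (@first_in _ W (l2 ++ [w])) as [j1 [b [j2 [E2 [Hb Hj]]]]].
  { exists w. rewrite in_app_iff. simpl; auto. }
  exists a, b, (a :: (k2 ++ z :: j1) ++ [b]). split.
  - split; [|split]; auto. exists (k2 ++ z :: j1), k1, j2. repeat split.
    + rewrite <- app_assoc. simpl. rewrite E2, app_comm_cons, E1.
      app_normalize. reflexivity.
    + intros x Hx. apply in_app_or in Hx. destruct Hx as [Hx|[<-|Hx]]; auto.
  - rewrite inner_ends, in_app_iff. simpl; auto.
Qed.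

Lemma segment_edge u m w x y :
  W u -> W w -> consecutive x y (u :: m ++ [w]) ->
  exists a b s, segment (u :: m ++ [w]) a b s /\ consecutive x y s.
Proof.
  intros Hu Hw [l1 [l2 E]].
  destruct (@last_in _ W (l1 ++ [x])) as [k1 [a [k2 [E1 [Ha Hk]]]]].
  { exists u. split; auto. destruct l1; injection E as -> _; simpl; auto. }
  destruct (@first_in _ W (y :: l2)) as [j1 [b [j2 [E2 [Hb Hj]]]]].
  { exists w. split; auto. destruct (exists_last (l := y :: l2)) as [l3 [w' E3]];
      [discriminate|]. rewrite E3 in *.
    rewrite app_comm_cons in E. replace (l1 ++ x :: l3 ++ [w']) with ((l1 ++ x :: l3) ++ [w']) in E.
    - apply app_inj_tail in E. destruct E as [_ ->]. apply in_or_app. simpl; auto.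
    - now rewrite <- app_assoc. }
  exists a, b, (a :: (k2 ++ j1) ++ [b]). split.
  - split; [|split]; auto. exists (k2 ++ j1), k1, j2. repeat split.
    + rewrite E. change (x :: y :: l2) with ([x] ++ (y :: l2)).
      rewrite app_assoc, E1, E2. app_normalize. reflexivity.
    + intros z Hz. apply in_app_or in Hz. destruct Hz; auto.
  - destruct (exists_last (l := a :: k2)) as [k3 [x' E3]]; [discriminate|].
    assert (x' = x).
    { rewrite E3, app_assoc in E1. now apply app_inj_tail in E1. }
    subst x'. rewrite app_comm_cons, app_comm_cons, E3.
    destruct j1 as [|y' j1]; injection E2 as <- E2.
    + exists k3, []. now rewrite app_nil_r, <- app_assoc.
    + exists k3, (j1 ++ [b]). now rewrite <- !app_assoc.
Qed.

(** Induction on the position of [z]: the last vertex of [W] before [z] is joined to [z] by a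
    segment. *)
Lemma segments_reach (K : graph T) u p :
  W u -> (forall a b s, segment (u :: p) a b s -> adj K a b) ->
  forall z, In z (u :: p) -> W z -> reach K u z.
Proof.
  intros Hu HK.
  assert (H : forall n l1 z l2, length l1 < n -> u :: p = l1 ++ z :: l2 -> W z -> reach K u z).
  { induction n as [|n IH]; intros l1 z l2 Hn E Hz; [lia|].
    destruct l1 as [|c l1]; injection E as <- E; [apply rt_refl|].
    destruct (@last_in _ W (u :: l1)) as [k1 [a [k2 [E1 [Ha Hk]]]]].
    { exists u. simpl; auto. }
    assert (E2 : u :: p = k1 ++ (a :: k2 ++ [z]) ++ l2).
    { rewrite E, app_comm_cons, E1. app_normalize. reflexivity. }
    apply rt_trans with a.
    - apply (IH k1 a (k2 ++ [z] ++ l2)); auto.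
      + apply (f_equal (@length T)) in E1. rewrite length_app in E1. simpl in *. lia.
      + rewrite E2. app_normalize. reflexivity.
    - apply rt_step. apply (HK a z (a :: k2 ++ [z])). split; [|split]; auto.
      exists k2, k1, l2. auto. }
  intros z Hz HW. apply in_split in Hz. destruct Hz as [l1 [l2 E]].
  exact (H (S (length l1)) l1 z l2 (le_n _) E HW).
Qed.

End Segments.

(** * The union of a sparse sequence of paths *)

Section PathUnion.
Variables (T : Type) (H : graph T) (u w : T) (W : T -> Prop) (r : nat -> list T).
Hypothesis (Hwf : wf_graph H) (Hsep : all_separated H) (Huw : u <> w).
Hypothesis Hpath : forall k, is_path H u w (r k).
Hypothesis Hmeet : forall j k z, In z (r j) -> In z (r k) -> ~ W z -> j = k.
Hypothesis Hpair : forall j k a b s t, segment W (r j) a b s ->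
  segment W (r k) a b t \/ segment W (r k) b a t -> j = k.
Hypothesis Hall : forall z, W z -> eventually (fun k => In z (r k)).
Hypothesis (Wu : W u) (Ww : W w).

Definition path_union : graph T :=
  Graph (fun z => exists k, In z (r k))
        (fun x y => exists k, consecutive x y (r k) \/ consecutive y x (r k)).

(** The list [s] always runs from [a] to [b], even where the path of the sequence traverses it
    backwards. *)
Definition trace_path (a b : T) (s : list T) : Prop :=
  exists k, segment W (r k) a b s \/ segment W (r k) b a (rev s).

(** The graph on [W] obtained from the union by suppressing all vertices outside [W]. *)
Definition trace_graph : graph T := Graph W (fun a b => exists s, trace_path a b s).

Lemma path_nodup k : NoDup (r k).
Proof. apply Hpath. Qed.

Lemma path_union_subgraph : subgraph path_union H.
Proof.
  destruct Hwf as (Hs & Hi & Hv).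
  assert (Hadj : forall x y, adj path_union x y -> adj H x y).
  { intros x y [k Hk]. destruct (Hpath k) as (_ & _ & Hw & _).
    rewrite walk_consecutive in Hw. destruct Hk; auto. }
  split; [|split]; auto.
  - split; [|split].
    + intros x y [k Hk]. exists k. tauto.
    + intros x Hx. apply (Hi x). auto.
    + intros x y [k [Hk|Hk]]; destruct (consecutive_in Hk); split; exists k; auto.
  - intros x [k Hk]. now apply (Hpath k).
Qed.

Lemma trace_path_sym a b s : trace_path a b s -> trace_path b a (rev s).
Proof. intros [k Hk]. exists k. rewrite rev_involutive. tauto. Qed.

(** By [Hpair] both traces come from the same path, which has at most one segment between [a] and
    [b], in one direction only. *)
Lemma trace_path_unique a b s t : trace_path a b s -> trace_path a b t -> s = t.
Proof.
  intros [j [Hj|Hj]] [k [Hk|Hk]].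
  - assert (j = k) as -> by (eapply Hpair; eauto). exact (segment_unique (path_nodup k) Hj Hk).
  - assert (j = k) as -> by (eapply Hpair; eauto).
    now destruct (segment_not_rev (path_nodup k) Hj Hk).
  - assert (j = k) as -> by (eapply Hpair; eauto).
    now destruct (segment_not_rev (path_nodup k) Hj Hk).
  - assert (j = k) as -> by (eapply Hpair; eauto).
    rewrite <- (rev_involutive s), <- (rev_involutive t). f_equal.
    exact (segment_unique (path_nodup k) Hj Hk).
Qed.

Lemma segment_is_path k a b s : segment W (r k) a b s -> is_path path_union a b s.
Proof.
  intros Hs. destruct (segment_nodup (path_nodup k) Hs) as [Hnd _].
  assert (Hin := fun z => @segment_in _ _ _ _ _ _ z Hs).
  destruct Hs as (_ & _ & m & l1 & l2 & -> & E & _). apply path_intro; auto.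
  - intros z Hz. exists k. auto.
  - intros x y Hxy. exists k. left. rewrite E. now apply consecutive_app.
Qed.

Lemma trace_path_spec a b s : trace_path a b s ->
  W a /\ W b /\ a <> b /\ is_path path_union a b s /\ forall z, In z (inner s) -> ~ W z.
Proof.
  intros [k [Hk|Hk]]; pose proof Hk as (H1 & H2 & _);
    destruct (segment_nodup (path_nodup k) Hk) as [_ Hab];
    (split; [auto|split; [auto|split; [congruence|split]]]).
  - exact (segment_is_path Hk).
  - intros z Hz. apply (segment_inner Hk Hz).
  - rewrite <- (rev_involutive s). apply path_rev; auto.
    + apply path_union_subgraph.
    + exact (segment_is_path Hk).
  - intros z Hz. apply (@segment_inner _ _ _ _ _ _ z Hk).
    rewrite inner_rev. now apply -> in_rev.
Qed.

Lemma trace_graph_wf : wf_graph trace_graph.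
Proof.
  split; [|split].
  - intros a b [s Hs]. exists (rev s). now apply trace_path_sym.
  - intros a [s Hs]. apply trace_path_spec in Hs. tauto.
  - intros a b [s Hs]. apply trace_path_spec in Hs. simpl. tauto.
Qed.

(** An arbitrary choice suffices: traces are unique, which forces the paths chosen for [ab] and [ba]
    to be reverse to each other. *)
Definition edge_path (a b : T) : list T := epsilon (inhabits []) (trace_path a b).

Lemma edge_path_spec a b : adj trace_graph a b -> trace_path a b (edge_path a b).
Proof. apply epsilon_spec. Qed.

Lemma path_union_subdivision : subdivision_of path_union trace_graph.
Proof.
  split; [apply path_union_subgraph|]. split; [exact trace_graph_wf|]. split.
  { intros z Hz. destruct (Hall Hz) as [N HN]. exists N. now apply HN. }
  exists edge_path. split; [|split; [|split]].
  - intros a b Hab. pose proof (edge_path_spec Hab) as Hs.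
    destruct (trace_path_spec Hs) as (_ & _ & _ & Hp & Hi). split; [|split]; auto.
    apply trace_path_sym in Hs. apply trace_path_unique with b a; auto.
    apply edge_path_spec. now apply trace_graph_wf.
  - intros a b c d Hab Hcd Hn1 Hn2 z Hz Hz'.
    assert (Hor : forall a b s, trace_path a b s -> In z (inner s) -> exists k a' b' s',
      segment W (r k) a' b' s' /\ In z (inner s') /\
      ((a' = a /\ b' = b) \/ (a' = b /\ b' = a))).
    { intros a0 b0 s [k [Hk|Hk]] Hin.
      - exists k, a0, b0, s. auto.
      - exists k, b0, a0, (rev s). rewrite inner_rev, <- in_rev. auto 6. }
    destruct (Hor _ _ _ (edge_path_spec Hab) Hz) as (k & a' & b' & s & Hs & Hzs & Es).
    destruct (Hor _ _ _ (edge_path_spec Hcd) Hz') as (j & c' & d' & t & Ht & Hzt & Et).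
    destruct (segment_inner Hs Hzs) as [Hzw Hk], (segment_inner Ht Hzt) as [_ Hj].
    rewrite (Hmeet Hk Hj Hzw) in Hs.
    destruct (segment_inner_unique (path_nodup j) Hs Ht Hzs Hzt) as [-> ->].
    destruct Es as [[-> ->]|[-> ->]], Et as [[-> ->]|[-> ->]]; tauto.
  - intros z [k Hk]. destruct (classic (W z)) as [Hz|Hz]; [left; auto|right].
    destruct (path_ends (Hpath k) Huw) as [m E]. rewrite E in Hk.
    destruct (segment_vertex Wu Ww Hk Hz) as (a & b & s & Hs & Hi).
    rewrite <- E in Hs. assert (Ht : trace_path a b s) by (exists k; auto).
    assert (Hab : adj trace_graph a b) by (exists s; auto).
    exists a, b. split; auto. now rewrite (trace_path_unique (edge_path_spec Hab) Ht).
  - assert (He : forall x y k, consecutive x y (r k) ->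
      exists a b, adj trace_graph a b /\ consecutive x y (edge_path a b)).
    { intros x y k Hk. destruct (path_ends (Hpath k) Huw) as [m E]. rewrite E in Hk.
      destruct (segment_edge Wu Ww Hk) as (a & b & s & Hs & Hi).
      rewrite <- E in Hs. assert (Ht : trace_path a b s) by (exists k; auto).
      assert (Hab : adj trace_graph a b) by (exists s; auto).
      exists a, b. split; auto. now rewrite (trace_path_unique (edge_path_spec Hab) Ht). }
    intros x y [k [Hk|Hk]]; [eauto|].
    destruct (He _ _ _ Hk) as (a & b & Hab & Hc). exists b, a.
    assert (Hba : adj trace_graph b a) by now apply trace_graph_wf.
    split; auto. apply consecutive_rev in Hc.
    rewrite (trace_path_unique (edge_path_spec Hba) (trace_path_sym (edge_path_spec Hab))).
    exact Hc.
Qed.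

(** Each edge in [F] is the trace of at most one path, so late paths have no segment in [F]. A late
    path that contains [z] then links [u] to [z]. *)
Lemma trace_graph_edge_connected : inf_edge_connected trace_graph.
Proof.
  split; [exists u, w; exact (conj Wu (conj Ww Huw))|].
  intros F. split; [exists u; exact Wu|].
  assert (HF : eventually (fun k => forall e, In e F ->
    forall s, ~ segment W (r k) (fst e) (snd e) s /\ ~ segment W (r k) (snd e) (fst e) s)).
  { apply eventually_forall_list. intros [a b] _. simpl.
    destruct (classic (exists k s, segment W (r k) a b s \/ segment W (r k) b a s))
      as [(k & s & Hk)|Hn].
    - exists (S k). intros n Hn s'. split; intros Hs; enough (n = k) by lia;
        (destruct Hk; eapply Hpair; eauto).
    - exists 0. intros n _ s. split; intros Hs; apply Hn; eauto. }
  assert (Hr : forall z, W z -> reach (remove_edges trace_graph F) u z).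
  { intros z Hz. destruct (eventually_and HF (Hall Hz)) as [k Hk].
    destruct (Hk k (le_n _)) as [Hk1 Hk2].
    destruct (path_ends (Hpath k) Huw) as [m E].
    apply segments_reach with (W := W) (p := m ++ [w]); auto; rewrite <- E; auto.
    intros a b s Hs. split; [exists s, k; auto|].
    split; intros He; now destruct (Hk1 _ He s). }
  assert (Hs : forall x y, adj (remove_edges trace_graph F) x y ->
    adj (remove_edges trace_graph F) y x).
  { intros x y (H1 & H2 & H3). repeat split; auto. now apply trace_graph_wf. }
  intros x y Hx Hy. apply reach_path; auto.
  - intros a b (Hab & _). now apply trace_graph_wf.
  - apply rt_trans with u; [|exact (Hr y Hy)].
    apply reach_sym; [exact Hs|exact (Hr x Hx)].
Qed.

(** Finite separation passes from [H] to the subgraph [path_union], and from there down to the graph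
    that it subdivides. *)
Lemma path_union_pi : subdivided_pi path_union trace_graph.
Proof.
  split; [|exact path_union_subdivision]. split; [exact trace_graph_wf|].
  split; [exact trace_graph_edge_connected|].
  apply all_separated_no_inf_disjoint.
  apply subdivision_all_separated_down with path_union; [exact path_union_subdivision|].
  destruct path_union_subgraph as (_ & Hv & Ha).
  intros a b Va Vb Hab. destruct (Hsep (Hv _ Va) (Hv _ Vb) Hab) as [S HS].
  exists S. intros Hr. apply HS. revert Hr. apply avoiding_mono; auto.
  intros x; auto.
Qed.

End PathUnion.

(** * Thinning out a family of paths *)

Section PathFamily.
Variables (T : Type) (H : graph T) (u w : T) (p : nat -> list T).
Hypothesis (Hwf : wf_graph H) (Hsep : all_separated H) (Hadj : adj H u w).
Hypothesis Hpath : forall k, is_path H u w (p k).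
Hypothesis Hedge : forall x y, eventually (fun k => ~ consecutive x y (p k)).

Lemma vertex_dichotomy :
  exists f : nat -> nat, (forall m n, m < n -> f m < f n) /\
    forall z, eventually (fun n => In z (p (f n))) \/ eventually (fun n => ~ In z (p (f n))).
Proof.
  (* The vertices on the paths are enumerated by pairs of a path index and a position; beyond the
     end of a path the default vertex [u] is listed. *)
  destruct (@diagonal (fun k n =>
    In (nth (snd (of_nat k)) (p (fst (of_nat k))) u) (p n))) as [f [Hf Hd]].
  exists f. split; auto. intros z.
  destruct (classic (exists i, In z (p i))) as [[i Hi]|Hn].
  - destruct (In_nth _ _ u Hi) as [j [_ Hj]]. specialize (Hd (to_nat (i, j))).
    rewrite cancel_of_to in Hd. simpl in Hd. now rewrite Hj in Hd.
  - right. exists 0. eauto.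
Qed.

Lemma pi_subgraph : exists D Gam, subgraph D H /\ subdivided_pi D Gam /\
  vert Gam u /\ vert Gam w /\ adj D u w /\ forall z, vert D z -> exists i, In z (p i).
Proof.
  destruct Hwf as (Hs & Hi & Hv).
  assert (Huw : u <> w) by (intros E; rewrite E in Hadj; exact (Hi _ Hadj)).
  destruct vertex_dichotomy as [f [Hf Hdic]].
  set (q n := p (f n)) in *. set (W z := eventually (fun n => In z (q n))).
  assert (Hq : forall n, exists m, q n = u :: m ++ [w]).
  { intros n. exact (path_ends (Hpath (f n)) Huw). }
  assert (Hends : forall n, In u (q n) /\ In w (q n)).
  { intros n. destruct (Hq n) as [m ->]. split; [left; auto|].
    right. apply in_or_app. simpl; auto. }
  assert (Wu : W u) by (exists 0; intros n _; apply Hends).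
  assert (Ww : W w) by (exists 0; intros n _; apply Hends).
  (* Otherwise a finite separator of [a] and [b] meets infinitely many of these segments inside. One
     of its vertices outside [W] then lies on infinitely many paths, against the dichotomy. *)
  assert (Hseg : forall a b, W a -> W b ->
    eventually (fun n => forall s, ~ segment W (q n) a b s)).
  { intros a b Wa Wb. apply NNPP. intros Hn. apply not_eventually in Hn.
    assert (Hn1 : frequently (fun n => exists s, segment W (q n) a b s)).
    { eapply frequently_impl; [|exact Hn]. intros n H1. apply NNPP. intros H2.
      apply H1. eauto. }
    clear Hn. destruct (Hn1 0) as [n0 [_ [s0 Hs0]]].
    destruct (segment_nodup (proj1 (Hpath _)) Hs0) as [_ Hab].
    assert (Hvq : forall n z, In z (q n) -> vert H z) by (intros n; apply (Hpath (f n))).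
    destruct (segment_ends Hs0) as [Ha Hb].
    destruct (Hsep (Hvq _ _ Ha) (Hvq _ _ Hb) Hab) as [S HS].
    (* Segments consisting of the single edge [ab] need not meet the separator; by [Hedge] only
       finitely many paths contain one. *)
    assert (He := eventually_subseq Hf (Hedge a b)). simpl in He. fold q in He.
    assert (Hfr := frequently_eventually Hn1 He). clear Hn1 He.
    destruct (@pigeonhole _ S (fun z n => ~ W z /\ In z (q n))) as [z [Hz Hfz]].
    - eapply frequently_impl; [|exact Hfr]. intros n [[s Hseg] Hnc]. simpl in Hnc.
      apply NNPP. intros Hno. apply HS.
      assert (Hin := fun z => @segment_inner _ _ _ _ _ _ z Hseg).
      destruct (segment_nodup (proj1 (Hpath _)) Hseg) as [Hnd _].
      assert (Hin' := fun z => @segment_in _ _ _ _ _ _ z Hseg).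
      destruct Hseg as (_ & _ & m & l1 & l2 & -> & E & _). rewrite inner_ends in Hin.
      apply path_avoiding with m.
      + apply path_intro; auto.
        * intros z Hz. apply (Hvq n). auto.
        * intros x y Hxy. destruct (Hpath (f n)) as (_ & _ & Hw & _).
          rewrite walk_consecutive in Hw. apply Hw. fold (q n). rewrite E.
          now apply consecutive_app.
      + intros ->. apply Hnc. fold (q n). rewrite E. exists l1, l2. auto.
      + intros z Hz HzS. apply Hno. exists z. split; auto.
    - destruct (Hfz 0) as [n [_ [HnW _]]].
      destruct (Hdic z) as [Hd|Hd]; [auto|].
      destruct (frequently_eventually Hfz Hd 0) as [j [_ [[_ H1] H2]]]. auto. }
  (* A new path shares only vertices of [W] with the earlier ones, and has no segment between two
     vertices already seen. Both [u] and [w] count as seen, since the edge [uw] will be put in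
     front. *)
  destruct (@greedy _ (fun l n => (forall m, In m l -> m < n) /\
    (forall z, In z (u :: w :: concat (map q l)) -> ~ W z -> ~ In z (q n)) /\
    (forall a b, In a (u :: w :: concat (map q l)) -> In b (u :: w :: concat (map q l)) ->
       W a -> W b -> forall s, ~ segment W (q n) a b s))) as [g Hg].
  { intros l. set (L := u :: w :: concat (map q l)).
    assert (H1 : eventually (fun n => forall m, In m l -> m < n)).
    { apply eventually_forall_list. intros m _. exists (S m). auto. }
    assert (H2 : eventually (fun n => forall z, In z L -> ~ W z -> ~ In z (q n))).
    { apply eventually_forall_list. intros z _. destruct (Hdic z) as [Hd|Hd].
      - exists 0. intros n _ HW. now destruct HW.
      - eapply eventually_impl; [|exact Hd]. auto. }
    assert (H3 : eventually (fun n => forall a, In a L -> forall b, In b L ->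
      W a -> W b -> forall s, ~ segment W (q n) a b s)).
    { apply eventually_forall_list. intros a _. apply eventually_forall_list. intros b _.
      destruct (classic (W a /\ W b)) as [[Wa Wb]|Hn].
      - eapply eventually_impl; [|exact (Hseg a b Wa Wb)]. auto.
      - exists 0. tauto. }
    destruct (eventually_and H1 (eventually_and H2 H3)) as [n Hn].
    exists n. destruct (Hn n (le_n _)) as (A & B & C). repeat split; auto. }
  set (r k := match k with 0 => [u; w] | S k => q (g k) end).
  assert (Hlt : forall j k, j < k -> exists n L, r k = q n /\ (forall z, In z (r j) -> In z L) /\
    (forall z, In z L -> ~ W z -> ~ In z (q n)) /\
    (forall a b, In a L -> In b L -> W a -> W b -> forall s, ~ segment W (q n) a b s)).
  { intros j [|k] Hjk; [lia|]. destruct (Hg k) as [l (_ & Hl & _ & H2 & H3)].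
    exists (g k), (u :: w :: concat (map q l)). repeat split; auto.
    intros z Hz. destruct j as [|j]; simpl in Hz |- *; [tauto|].
    right. right. apply in_concat. exists (q (g j)). split; auto.
    apply in_map. apply Hl. lia. }
  assert (Hrp : forall k, is_path H u w (r k)).
  { intros [|k]; [|apply (Hpath (f (g k)))]. apply (@path_intro _ H u [] w); simpl.
    - repeat constructor; simpl; intuition.
    - intros z [<-|[<-|[]]]; now apply (Hv u w).
    - intros a b Hab. apply consecutive_cons in Hab.
      destruct Hab as [[-> E]|Hab]; [now injection E as <-|].
      destruct Hab as [[|? [|]] [? ?]]; discriminate. }
  assert (Hmeet : forall j k z, j < k -> In z (r j) -> In z (r k) -> W z).
  { intros j k z Hjk Hj Hk. destruct (Hlt j k Hjk) as (n & L & E & H1 & H2 & _).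
    apply NNPP. intros Hn. apply (H2 z); auto. now rewrite <- E. }
  assert (Hpair : forall j k a b s t, j < k -> segment W (r j) a b s ->
    ~ segment W (r k) a b t /\ ~ segment W (r k) b a t).
  { intros j k a b s t Hjk Hj. destruct (Hlt j k Hjk) as (n & L & -> & H1 & _ & H3).
    destruct (segment_ends Hj). destruct Hj as (Wa & Wb & _). split; apply H3; auto. }
  exists (path_union r), (trace_graph W r). split; [|split; [|split; [|split; [|split]]]].
  - now apply path_union_subgraph with (u := u) (w := w).
  - apply path_union_pi with (H := H) (u := u) (w := w); auto.
    + intros j k z Hj Hk Hz. destruct (Nat.lt_total j k) as [E|[E|E]]; auto; exfalso; eauto.
    + intros j k a b s t Hj Hk. destruct (Nat.lt_total j k) as [E|[E|E]]; auto; exfalso.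
      * destruct (Hpair _ _ _ _ _ t E Hj). tauto.
      * destruct Hk as [Hk|Hk]; destruct (Hpair _ _ _ _ _ s E Hk); tauto.
    (* The successor accounts for the edge [uw] at index 0. *)
    + intros z [N HN]. exists (S N). intros [|k] Hk; [lia|]. simpl. apply HN.
      assert (k <= g k); [|lia]. apply increasing_ge. intros m n Hmn.
      destruct (Hg n) as [l (_ & Hl & H1 & _)]. auto.
  - exact Wu.
  - exact Ww.
  - exists 0. left. exists [], []. auto.
  - intros z [[|k] Hk].
    (* The vertices of the edge [uw] lie on every path, so any index serves. *)
    + exists (f 0). destruct (Hends 0). destruct Hk as [<-|[<-|[]]]; auto.
    + exists (f (g k)). exact Hk.
Qed.

End PathFamily.
(** * Splitting the graph between two branch vertices *)

Section Expansion.
Variables (T : Type) (G : graph T) (X : T -> Prop) (D : graph (option T)).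
Hypothesis (Hwf : wf_graph G) (HX : forall x, X x -> vert G x).
Hypothesis (HD : subgraph D (contract G X)) (HN : vert D None).

(** The quotient map from the vertices of [G] to those of [G/X]. *)
Definition contract_vertex (x : T) : option T :=
  if excluded_middle_informative (X x) then None else Some x.

Lemma contract_vertex_in x : X x -> contract_vertex x = None.
Proof. unfold contract_vertex. destruct excluded_middle_informative; tauto. Qed.

Lemma contract_vertex_out x : ~ X x -> contract_vertex x = Some x.
Proof. unfold contract_vertex. destruct excluded_middle_informative; tauto. Qed.

(* The largest subgraph of [G] whose contraction is [D]. *)
Definition expand : graph T :=
  Graph (fun x => X x \/ vert D (Some x))
    (fun x y => adj G x y /\
       ((X x /\ X y) \/ adj D (contract_vertex x) (contract_vertex y))).

Lemma expand_subgraph : subgraph expand G.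
Proof.
  destruct Hwf as (Hs & Hi & Hv), HD as ((Hs' & Hi' & Hv') & Hvert & Hadj).
  assert (Hc : forall x, vert D (contract_vertex x) -> vert expand x).
  { intros x Hx. destruct (classic (X x)) as [H|H]; [left; auto|].
    right. now rewrite contract_vertex_out in Hx. }
  split; [split; [|split]|split].
  - intros x y [H1 H2]. split; auto. destruct H2 as [[H2 H3]|H2]; auto.
  - intros x [H _]. exact (Hi _ H).
  - intros x y [H1 [[H2 H3]|H2]]; [split; left; auto|].
    destruct (Hv' _ _ H2). auto.
  - intros x [H|H]; auto. apply Hvert in H. apply H.
  - intros x y [H _]. auto.
Qed.

(** Stated as an equality, so that what is known about [D] carries over to the contraction by
    rewriting. *)
Lemma contract_expand : contract expand X = D.
Proof.
  destruct Hwf as (Hs & Hi & Hv), HD as ((Hs' & Hi' & Hv') & Hvert & Hadj).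
  assert (HN1 : forall y, (exists x, X x /\ adj expand x y) /\ ~ X y <-> adj D None (Some y)).
  { intros y. split.
    - intros [[x [Hx [H [[_ H1]|H1]]]] Hy]; [tauto|].
      now rewrite contract_vertex_in, contract_vertex_out in H1.
    - intros H. pose proof (Hadj _ _ H) as (_ & Hy & x & Hx & Hxy).
      split; auto. exists x. split; [auto|]. split; [auto|right].
      now rewrite contract_vertex_in, contract_vertex_out. }
  assert (HSS : forall x y, adj expand x y /\ ~ X x /\ ~ X y <-> adj D (Some x) (Some y)).
  { intros x y. split.
    - intros [[H1 [H2|H2]] [Hx Hy]]; [tauto|]. now rewrite !contract_vertex_out in H2.
    - intros H. pose proof (Hadj _ _ H) as (Hxy & Hx & Hy). repeat split; auto.
      right. now rewrite !contract_vertex_out. }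
  assert (HV : forall x, vert expand x /\ ~ X x <-> vert D (Some x)).
  { intros x. split.
    - intros [[H|H] H']; tauto.
    - intros H. pose proof (Hvert _ H) as [_ H1]. split; [right|]; auto. }
  assert (Hsym : forall x y, adj expand x y -> adj expand y x) by apply expand_subgraph.
  assert (Ev : vert (contract expand X) = vert D).
  { apply functional_extensionality. intros [x|]; apply propositional_extensionality.
    - apply HV.
    - simpl; tauto. }
  assert (Ea : adj (contract expand X) = adj D).
  { apply functional_extensionality. intros o. apply functional_extensionality. intros o'.
    apply propositional_extensionality. destruct o as [x|], o' as [y|].
    - apply HSS.
    - split.
      + intros (H1 & H2 & z & Hz & Hxz). apply Hs'. apply HN1. eauto.
      + intros H. apply Hs' in H. destruct (Hv' _ _ H) as [_ H1].
        apply HN1 in H. destruct H as [[z [Hz Hxz]] Hx].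
        split; [now right|]. split; eauto.
    - split.
      + intros (H1 & H2 & z & Hz & Hxz). apply HN1. eauto.
      + intros H. destruct (Hv' _ _ H) as [_ H1].
        apply HN1 in H. destruct H as [[z [Hz Hxz]] Hx].
        split; [now right|]. split; eauto.
    - split; [intros []|apply Hi']. }
  destruct (contract expand X), D. simpl in *. now subst.
Qed.

End Expansion.

(** * Cutting edge-disjoint paths at the contracted set *)

Lemma prefix_before T (l1 l2 l l' : list T) x s :
  l1 ++ x :: l2 = l ++ s :: l' -> ~ In s l1 -> incl l1 l.
Proof.
  revert l. induction l1 as [|c l1 IH]; intros l E Hs z Hz; [destruct Hz|].
  destruct l as [|d l]; injection E as -> E.
  - destruct Hs. left; auto.
  - destruct Hz as [->|Hz]; [left; auto|right].
    refine (IH l E _ z Hz). intros H. apply Hs. right; auto.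
Qed.

Lemma consecutive_map_some T (l : list T) o o' :
  consecutive o o' (map Some l ++ [None]) ->
  exists a, o = Some a /\
    ((exists b, o' = Some b /\ consecutive a b l) \/ (o' = None /\ exists k, l = k ++ [a])).
Proof.
  induction l as [|c l IH]; simpl; intros H; apply consecutive_cons in H.
  - destruct H as [[_ H]|[[|] [? H]]]; discriminate.
  - destruct H as [[-> H]|H].
    + exists c. split; auto. destruct l as [|d l]; injection H as <-.
      * right. split; auto. exists []. auto.
      * left. exists d. split; auto. exists [], l. auto.
    + destruct (IH H) as [a [-> [[b [-> Hb]]|[-> [k ->]]]]]; exists a; split; auto.
      * left. exists b. split; auto. apply consecutive_cons. auto.
      * right. split; auto. exists (c :: k). auto.
Qed.

(** Each [Q i] is cut at its first vertex in [X], which gives a path from [u] to the contracted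
    vertex. Since [s] is in [X], the cut comes no later than [s], so the part before it avoids [S]
    apart from the ends. This keeps [D] on the side of [u]. *)
Lemma one_side T (G : graph T) (S l : list T) (X : T -> Prop) (u v s : T)
    (Q : nat -> list T) :
  wf_graph G -> all_separated G -> u <> v ->
  (forall i, is_path G u v (Q i)) -> (forall i, ~ consecutive u v (Q i)) ->
  (forall i j x y, consecutive x y (Q i) -> consecutive x y (Q j) -> i = j) ->
  (forall x, X x -> In x l /\ vert G x) -> ~ X u -> (exists x, X x /\ adj G u x) -> X s ->
  (forall i, exists l1 l2, Q i = l1 ++ s :: l2 /\
     forall z, In z l1 -> In z S -> z = u \/ z = v) ->
  exists D Gam, subgraph D (contract G X) /\ subdivided_pi D Gam /\
    vert Gam (Some u) /\ vert Gam None /\ adj D (Some u) None /\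
    forall z, vert D (Some z) -> reach (avoiding G S u v) u z.
Proof.
  intros Hwf Hsep Huv HQ Hnuv Hdisj Hl Hu [x0 [Hx0 Hux0]] Hs Hpre.
  assert (Hdec : forall i, exists L, exists x l2 l1 l2', Q i = (u :: L) ++ x :: l2 /\ X x /\
    (forall y, In y (u :: L) -> ~ X y) /\ Q i = l1 ++ s :: l2' /\ incl (u :: L) l1 /\
    forall z, In z l1 -> In z S -> z = u \/ z = v).
  { intros i. destruct (Hpre i) as [l1 [l2' [E Hl1]]].
    destruct (@first_in _ X (Q i)) as [L [x [l2 [E1 [Hx HL]]]]].
    { exists s. split; auto. rewrite E. apply in_or_app. simpl; auto. }
    destruct (path_ends (HQ i) Huv) as [m Em].
    destruct L as [|u' L].
    { rewrite E1 in Em. injection Em as -> _. tauto. }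
    rewrite E1 in Em. injection Em as -> _.
    exists L, x, l2, l1, l2'. split; [auto|]. split; [auto|]. split; [auto|]. split; [auto|].
    split; [|auto]. rewrite E1 in E. apply (prefix_before E). intros H. now apply (HL s). }
  destruct (choice_function Hdec) as [L HL]. clear Hdec Hpre.
  assert (Hsub : forall i x y, consecutive x y (u :: L i) -> consecutive x y (Q i)).
  { intros i x y Hxy. destruct (HL i) as (x1 & l2 & _ & _ & -> & _).
    rewrite <- (app_nil_l (_ ++ _)). now apply consecutive_app. }
  assert (HQadj : forall i x y, consecutive x y (Q i) -> adj G x y).
  { intros i x y Hxy. destruct (HQ i) as (_ & _ & Hw & _).
    rewrite walk_consecutive in Hw. auto. }
  assert (Hin : forall i z, In z (u :: L i) -> In z (Q i)).
  { intros i z Hz. destruct (HL i) as (x1 & l2 & _ & _ & -> & _). apply in_or_app. auto. }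
  assert (Hlast : forall i k a, u :: L i = k ++ [a] -> exists x, X x /\ consecutive a x (Q i)).
  { intros i k a E. destruct (HL i) as (x1 & l2 & _ & _ & E1 & Hx & _).
    exists x1. split; auto. rewrite E1, E. exists k, l2. now rewrite <- app_assoc. }
  assert (HLX : forall i y, In y (u :: L i) -> ~ X y).
  { intros i. destruct (HL i) as (x1 & l2 & l1 & l2' & _ & _ & H & _). exact H. }
  assert (Hev : forall x y, eventually (fun i => ~ consecutive x y (Q i))).
  { intros x y. apply NNPP. intros H. apply not_eventually in H.
    destruct (H 0) as [i [_ Hi]], (H (1 + i)) as [j [Hij Hj]]. apply NNPP in Hi, Hj.
    specialize (Hdisj i j x y Hi Hj). lia. }
  destruct (@pi_subgraph _ (contract G X) (Some u) None
    (fun i => map Some (u :: L i) ++ [None])) as (D & Gam & HD & Hpi & Vu & VN & Ha & HV).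
  - now apply contract_wf.
  - now apply contract_all_separated with l.
  - split; [|split; auto].
    + apply Hwf in Hux0. apply Hux0.
    + exists x0. auto.
  - intros i. apply (@path_intro _ (contract G X) (Some u) (map Some (L i)) None).
    + change (NoDup (map Some (u :: L i) ++ [None])). apply NoDup_app.
      * apply Injective_map_NoDup; [intros a b E; now injection E|].
        destruct (HQ i) as [Hnd _]. destruct (HL i) as (x1 & l2 & _ & _ & E & _).
        rewrite E in Hnd. now apply nodup_app_l in Hnd.
      * repeat constructor. intros [].
      * intros o Ho [<-|[]]. apply in_map_iff in Ho. destruct Ho as [? [? _]]. discriminate.
    + intros o Ho. change (In o (map Some (u :: L i) ++ [None])) in Ho.
      apply in_app_or in Ho. destruct Ho as [Ho|[<-|[]]]; [|exact I].
      apply in_map_iff in Ho. destruct Ho as [z [<- Hz]]. split.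
      * apply (HQ i). auto.
      * exact (HLX i z Hz).
    + intros o o' Ho. change (consecutive o o' (map Some (u :: L i) ++ [None])) in Ho.
      destruct (consecutive_map_some Ho) as [a [-> [[b [-> Hab]]|[-> [k E]]]]].
      * destruct (consecutive_in Hab). repeat split; eauto.
      * assert (Hia : In a (u :: L i)) by (rewrite E; apply in_or_app; simpl; auto).
        destruct (Hlast i k a E) as [x [Hx Hax]]. split; [|split]; eauto.
        apply (HQ i). auto.
  - intros o o'. destruct o as [a|].
    2: { exists 0. intros i _ Ho. apply consecutive_map_some in Ho.
         destruct Ho as [a [Ho _]]. discriminate. }
    (* An edge from [a] to the contracted vertex stems from one of finitely many edges from [a] to
       [X], each lying on at most one [Q i]. *)
    assert (H : eventually (fun i => forall x, In x l -> ~ consecutive a x (Q i))).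
    { apply eventually_forall_list. intros x _. apply Hev. }
    destruct o' as [b|].
    + eapply eventually_impl; [|exact (Hev a b)]. intros i Hn Ho. apply Hn. clear Hn.
      destruct (consecutive_map_some Ho) as [a' [E [[b' [E' Hab]]|[E' _]]]]; [|discriminate].
      injection E as ->. injection E' as ->. auto.
    + eapply eventually_impl; [|exact H]. intros i Hn Ho.
      destruct (consecutive_map_some Ho) as [a' [E [[b' [E' Hab]]|[_ [k Ek]]]]];
        [discriminate|]. injection E as <-.
      destruct (Hlast i k a Ek) as [x [Hx Hax]]. apply (Hn x); auto. now apply Hl.
  - exists D, Gam. repeat (split; [assumption|]).
    intros z Hz. destruct (HV _ Hz) as [i Hi]. apply in_app_or in Hi.
    destruct Hi as [Hi|[Hi|[]]]; [|discriminate].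
    apply in_map_iff in Hi. destruct Hi as [z' [E Hi]]. injection E as ->.
    apply walk_reach with (L i); auto. apply walk_consecutive. intros x y Hxy.
    destruct (HL i) as (x1 & l2 & l1 & l2' & _ & _ & _ & _ & Hincl & HS).
    destruct (consecutive_in Hxy) as [Hx Hy]. apply Hsub in Hxy.
    split; [exact (HQadj i _ _ Hxy)|]. repeat split; auto.
    + intros [-> ->]. exact (Hnuv i Hxy).
    + intros [-> ->]. destruct (path_ends (HQ i) Huv) as [m Em].
      pose proof (proj1 (HQ i)) as Hnd. rewrite Em in Hnd, Hxy.
      now destruct (consecutive_not_ends Hnd Hxy).
Qed.

(** Branch vertices stay connected in [G] after any finite set of edges is deleted, so the paths can
    be chosen greedily. *)
Lemma edge_disjoint_paths T (G Gam : graph T) (u v : T) :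
  subdivision_of G Gam -> inf_edge_connected Gam -> vert Gam u -> vert Gam v ->
  exists Q : nat -> list T,
    (forall i, is_path G u v (Q i)) /\ (forall i, ~ consecutive u v (Q i)) /\
    forall i j x y, consecutive x y (Q i) -> consecutive x y (Q j) -> i = j.
Proof.
  intros Hsub [_ Hc] Hu Hv.
  pose proof Hsub as (HwG & HwGam & Hvert & P & HP & HD & _).
  assert (Hr : forall F, reach (remove_edges G F) u v).
  { intros F. apply subdivision_reach_remove with (P := P) (Gam := Gam); auto.
    intros L. destruct (Hc L) as [_ H]. destruct (H u v Hu Hv) as [p (_ & _ & Hw & Hh & Hl)].
    destruct p as [|c p]; [discriminate|]. injection Hh as ->.
    apply walk_reach with p; auto. rewrite <- Hl.
    destruct (exists_last (l := u :: p)) as [m [z ->]]; [discriminate|].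
    rewrite last_last. apply in_or_app. simpl; auto. }
  destruct (@greedy _ (fun l p => is_path G u v p /\ ~ consecutive u v p /\
    forall q x y, In q l -> consecutive x y q -> ~ consecutive x y p)) as [Q HQ].
  (* Besides [uv], all pairs of vertices of an earlier path are forbidden: a finite set that
     includes its edges. *)
  - intros l. set (F := (u, v) :: concat (map (fun q => list_prod q q) l)).
    assert (Hp : exists p, is_path (remove_edges G F) u v p).
    { apply reach_path; [|exact (Hvert u Hu)|apply Hr].
      intros a b (Hab & _). now apply HwG. }
    destruct Hp as [p (Hnd & Hvp & Hw & Hh)].
    rewrite walk_consecutive in Hw. exists p. split; [|split].
    + repeat split; auto; try tauto. apply walk_consecutive.
      intros x y Hxy. exact (proj1 (Hw x y Hxy)).
    + intros Hn. destruct (Hw u v Hn) as (_ & H & _). apply H. left; auto.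
    + intros q x y Hq Hxy Hn. destruct (Hw x y Hn) as (_ & H & _). apply H.
      right. apply in_concat. exists (list_prod q q). split.
      * now apply (in_map (fun q => list_prod q q)).
      * destruct (consecutive_in Hxy). now apply in_prod.
  - exists Q. split; [|split].
    + intros i. destruct (HQ i) as [l H]. tauto.
    + intros i. destruct (HQ i) as [l H]. tauto.
    + assert (Hlt : forall i j x y, i < j -> consecutive x y (Q i) -> ~ consecutive x y (Q j)).
      { intros i j x y Hij Hi. destruct (HQ j) as [l (_ & Hl & _ & _ & H)]. eauto. }
      intros i j x y Hi Hj. destruct (Nat.lt_total i j) as [E|[E|E]]; auto; exfalso.
      * exact (Hlt _ _ _ _ E Hi Hj).
      * exact (Hlt _ _ _ _ E Hj Hi).
Qed.

Lemma inner_connected T (G H : graph T) (u v : T) (p : list T) (X : T -> Prop) :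
  wf_graph H -> is_path G u v p -> u <> v -> ~ consecutive u v p ->
  (forall x, vert H x <-> X x) ->
  (forall x, X x <-> In x (inner p)) ->
  (forall x y, adj G x y -> X x -> X y -> adj H x y) -> connected H.
Proof.
  intros HwH Hp Huv Hn HV HX Hadj. destruct (path_ends Hp Huv) as [m ->].
  rewrite inner_ends in HX. destruct m as [|c m].
  { destruct Hn. exists [], []. auto. }
  destruct Hp as (_ & _ & Hw & _). rewrite walk_consecutive in Hw.
  assert (Hr : forall x, vert H x -> reach H c x).
  { intros x Hx. apply HV, HX in Hx. apply walk_reach with m; auto.
    apply walk_consecutive. intros a b Hab. destruct (consecutive_in Hab).
    apply Hadj; try now apply HX. apply Hw.
    now apply (@consecutive_app _ a b (c :: m) [u] [v]). }
  split; [exists c; apply HV, HX; left; auto|].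
  intros x y Hx Hy. apply reach_path; auto; [apply HwH|].
  apply rt_trans with c; [|exact (Hr y Hy)]. apply reach_sym; [apply HwH|exact (Hr x Hx)].
Qed.

Theorem theorem6p1 (T : Type) (G Gam : graph T) (u v : T) :
  subdivided_pi G Gam -> vert Gam u -> vert Gam v -> u <> v ->
  exists Hu Hv : graph T,
    subgraph Hu G /\ subgraph Hv G /\
    (exists x, common_vert Hu Hv x) /\
    (* (i) *)
    same_graph (induced Hu (common_vert Hu Hv)) (induced Hv (common_vert Hu Hv)) /\
    finite_graph (induced Hu (common_vert Hu Hv)) /\
    connected (induced Hu (common_vert Hu Hv)) /\
    (* (ii) *)
    ~ common_vert Hu Hv u /\ ~ common_vert Hu Hv v /\
    (* (iii) *)
    (exists Gu : graph (option T),
       subdivided_pi (contract Hu (common_vert Hu Hv)) Gu /\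
       vert Gu (Some u) /\ vert Gu None) /\
    (exists Gv : graph (option T),
       subdivided_pi (contract Hv (common_vert Hu Hv)) Gv /\
       vert Gv (Some v) /\ vert Gv None) /\
    (* (iv) *)
    adj (contract Hu (common_vert Hu Hv)) (Some u) None /\
    adj (contract Hv (common_vert Hu Hv)) (Some v) None.
Proof.
  intros [(HwGam & Hiec & Hnd) Hsub] Hu Hv Huv.
  pose proof Hsub as (HwG & _ & Hvert & _).
  assert (Hsep : all_separated G).
  { apply (subdivision_all_separated Hsub). intros a b Ha Hb Hab.
    apply not_inf_disjoint_separated; auto. }
  destruct (edge_disjoint_paths Hsub Hiec Hu Hv) as (Q & HQ & HQuv & HQd).
  destruct (Hsep u v (Hvert _ Hu) (Hvert _ Hv) Huv) as [S HS].
  (* The separator without [u] and [v]; every [Q i] meets it, since it avoids the edge [uv]. *)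
  set (B z := In z S /\ z <> u /\ z <> v).
  set (first s i := exists l1 l2, Q i = l1 ++ s :: l2 /\ forall z, In z l1 -> ~ B z).
  set (final s i := exists l1 l2, Q i = l1 ++ s :: l2 /\ forall z, In z l2 -> ~ B z).
  assert (Hmeet : forall i, exists z, In z (Q i) /\ B z).
  { intros i. apply NNPP. intros Hn. apply HS. pose proof (HQ i) as Hp.
    destruct (path_ends Hp Huv) as [m E]. rewrite E in Hp. apply path_avoiding with m; auto.
    - intros ->. apply (HQuv i). rewrite E. exists [], []. auto.
    - intros z Hz HzS. apply Hn. exists z. rewrite E. split.
      + right. apply in_or_app. auto.
      + destruct (nodup_ends (proj1 Hp)) as (_ & H1 & H2 & _). unfold B.
        repeat split; auto; intros ->; auto. }
  destruct (@pigeonhole _ (list_prod S S) (fun e i =>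
    B (fst e) /\ B (snd e) /\ first (fst e) i /\ final (snd e) i)) as [[s s'] [_ Hf]].
  { intros N. exists N. split; auto.
    destruct (first_in (Hmeet N)) as (l1 & s & l2 & E & Hs & Hl1).
    destruct (last_in (Hmeet N)) as (l1' & s' & l2' & E' & Hs' & Hl2).
    exists (s, s'). split; [apply in_prod; [apply Hs|apply Hs']|].
    repeat split; try apply Hs; try apply Hs'; [exists l1, l2|exists l1', l2']; auto. }
  destruct (frequently_subseq Hf) as [f [Hinc HP]]. clear Hf. simpl in HP.
  set (q i := Q (f i)).
  assert (Hqd : forall i j x y, consecutive x y (q i) -> consecutive x y (q j) -> i = j).
  { intros i j x y Hi Hj. specialize (HQd _ _ _ _ Hi Hj).
    destruct (Nat.lt_total i j) as [E|[E|E]]; auto; apply Hinc in E; lia. }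
  assert (Hqp : forall i, is_path G u v (q i)) by (intros i; apply HQ).
  assert (Hquv : forall i, ~ consecutive u v (q i)) by (intros i; apply HQuv).
  (* The set to contract is the interior of one of the kept paths. It contains [s] and [s'], so
     every kept path meets it by its first vertex in [B] and again at its last. *)
  set (X x := In x (inner (q 0))).
  pose proof (Hqp 0) as Hp0.
  assert (HXG : forall x, X x -> In x (inner (q 0)) /\ vert G x).
  { intros x Hx. split; auto. apply Hp0. now apply inner_in. }
  destruct (path_ends Hp0 Huv) as [m Em].
  assert (HXm : forall x, X x <-> In x m).
  { intros x. unfold X. now rewrite Em, inner_ends. }
  assert (Hends : ~ X u /\ ~ X v).
  { rewrite !HXm. rewrite Em in Hp0. now destruct (nodup_ends (proj1 Hp0)) as (_ & ? & ? & _). }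
  assert (HBX : forall z, In z (q 0) -> B z -> X z).
  { intros z Hz (_ & H1 & H2). apply (in_inner Hp0) in Hz. unfold X. tauto. }
  destruct (HP 0) as (HBs & HBs' & H1 & H2).
  assert (Hs : X s).
  { destruct H1 as (l1 & l2 & E & _). apply HBX; auto. unfold q. rewrite E.
    apply in_or_app. simpl; auto. }
  assert (Hs' : X s').
  { destruct H2 as (l1 & l2 & E & _). apply HBX; auto. unfold q. rewrite E.
    apply in_or_app. simpl; auto. }
  assert (Hmne : m <> []).
  { intros ->. apply (Hquv 0). rewrite Em. exists [], []. auto. }
  assert (Hadj : forall x y, consecutive x y (q 0) -> adj G x y).
  { destruct Hp0 as (_ & _ & Hw & _). now apply walk_consecutive. }
  assert (HBS : forall z, ~ B z -> In z S -> z = u \/ z = v).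
  { intros z Hz HzS. apply NNPP. intros Hn. apply Hz. unfold B. tauto. }
  destruct (@one_side T G S (inner (q 0)) X u v s q)
    as (Du & Gu & HDu & Hpiu & Vu & VNu & Au & Ru); auto; [tauto|..].
  { destruct m as [|c m]; [tauto|]. exists c. split; [apply HXm; left; auto|].
    apply Hadj. rewrite Em. exists [], (m ++ [v]). auto. }
  { intros i. destruct (HP i) as (_ & _ & (l1 & l2 & E & H) & _). exists l1, l2. eauto. }
  (* The side of [v] follows by reversing all paths, which turns the last vertex [s'] in [B] into
     the first. *)
  destruct (@one_side T G S (inner (q 0)) X v u s' (fun i => rev (q i)))
    as (Dv & Gv & HDv & Hpiv & Vv & VNv & Av & Rv); auto.
  { intros i. apply path_rev; auto. apply HwG. }
  { intros i Hi. apply consecutive_rev in Hi. rewrite rev_involutive in Hi.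
    exact (Hquv _ Hi). }
  { intros i j x y Hi Hj. apply consecutive_rev in Hi, Hj. rewrite rev_involutive in Hi, Hj.
    eauto. }
  { tauto. }
  { destruct (exists_last Hmne) as [m' [c E]]. exists c. split.
    - apply HXm. rewrite E. apply in_or_app. simpl; auto.
    - apply HwG. apply Hadj. rewrite Em, E. exists (u :: m'), []. simpl.
      now rewrite <- app_assoc. }
  { intros i. destruct (HP i) as (_ & _ & _ & (l1 & l2 & E & H)).
    exists (rev l2), (rev l1). split.
    - unfold q. rewrite E, rev_app_distr. simpl. now rewrite <- app_assoc.
    - intros z Hz HzS. apply in_rev in Hz. destruct (HBS z); auto. }
  assert (HXv : forall x, X x -> vert G x) by (intros x Hx; now apply HXG).
  (* A common vertex outside [X] would be reachable from both [u] and [v] while avoiding [S], but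
     [S] separates them. *)
  assert (HC : common_vert (expand G X Du) (expand G X Dv) = X).
  { apply functional_extensionality. intros z. apply propositional_extensionality.
    unfold common_vert. simpl. split; [|auto]. intros [[Hz|Hz] [Hz'|Hz']]; auto.
    destruct HS. apply rt_trans with z; [exact (Ru z Hz)|]. apply reach_sym.
    - intros a b (A1 & A2 & A3 & A4 & A5). split; [now apply HwG|]. tauto.
    - apply Rv in Hz'. revert Hz'. apply reach_sub.
      intros a b (A1 & A2 & A3 & A4 & A5). apply rt_step. split; [auto|]. tauto. }
  assert (VDu : vert Du None) by (apply (proj2 Hpiu); auto).
  assert (VDv : vert Dv None) by (apply (proj2 Hpiv); auto).
  exists (expand G X Du), (expand G X Dv). rewrite HC.
  rewrite !contract_expand by assumption.
  split; [now apply expand_subgraph|]. split; [now apply expand_subgraph|].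
  split; [exists s; auto|]. split; [|split; [|split]].
  - split; simpl; [tauto|]. intros x y. split; intros ((H3 & _) & H4); tauto.
  - exists m. intros x [_ Hx]. now apply HXm.
  - apply (@inner_connected T G _ u v (q 0) X); auto.
    + destruct (expand_subgraph HwG HXv HDu) as ((E1 & E2 & E3) & _).
      split; [|split].
      * intros x y [A1 A2]. split; [auto|tauto].
      * intros x [A1 _]. exact (E2 x A1).
      * intros x y [A1 A2]. destruct (E3 x y A1). simpl in *. tauto.
    + intros x. simpl. tauto.
    + intros x. reflexivity.
    + intros x y A1 A2 A3. simpl. tauto.
  - split; [tauto|]. split; [tauto|]. split; [exists Gu; auto|]. split; [exists Gv; auto|].
    auto.
Qed.
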